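(* Let $n_p,m\ge1$, $n=2n_p$, let $1\le d_m\le d_n\le d_M$ be integers, and let $\mathrm A_p\in\mathbb R^{n_p\times n_p}$, $\mathrm B_p\in\mathbb R^{n_p\times m}$ with $(\mathrm A_p,\mathrm B_p)$ controllable. Given a scalar $\varepsilon\in(-1,0]$, assume that there exist matrices $\bar{\mathrm P}_1\in\mathbb S_{4n}^+$, $\bar{\mathrm P}_2\in\mathbb S_{3n}^+$, $\bar{\mathrm Q}_{1_j},\bar{\mathrm Q}_{2_j},\bar{\mathrm Z}_{1_j},\bar{\mathrm Z}_{2_j}\in\mathbb S_n^+$ and $\bar{\mathrm X}_j\in\mathbb R^{2n\times2n}$ for $j\in\{1,2\}$, $\bar{\mathrm Q}_{3_1},\bar{\mathrm Z}_{3_1}\in\mathbb S_n^+$, $\mathrm J=\mathrm{diag}(\mathrm U,\mathrm U)\in\mathbb R^{n\times n}$ with $\mathrm U\in\mathbb R^{n_p\times n_p}$, $\bar{\mathrm K},\bar{\mathrm F}\in\mathbb R^{m\times n_p}$ and $\bar{\mathrm L}\in\mathbb R^{n_p\times n_p}$ such that, for each $j\in\{1,2\}$, $$\bar\Psi_{z_j}\succ0,\qquad \bar\Phi(d_{m_j},j)+\bar\Upsilon_j\prec0,\qquad \bar\Phi(d_{M_j},j)+\bar\Upsilon_j\prec0,$$ and such that $$\big[\mathrm{diag}(\bar{\mathrm S}_1,0_n)-\mathrm{diag}(0_n,\bar{\mathrm S}_2)\big]+\mathrm{He}\{\mathcal I^\top\bar{\mathcal L}(l_1)\}\prec0,\quad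 l_1=d_{m_1},\dots,d_{M_1},$$ $$\big[\mathrm{diag}(\bar{\mathrm S}_2,0_n)-\mathrm{diag}(0_n,\bar{\mathrm S}_1)\big]+\mathrm{He}\{\mathcal I^\top\bar{\mathcal L}(l_2)\}\prec0,\quad l_2=d_{m_2},\dots,d_{M_2},$$ where all matrices are as defined in the context. Then the matrices $\mathrm K=\bar{\mathrm K}\mathrm U^{-\top}$, $\mathrm F=\bar{\mathrm F}\mathrm U^{-\top}$, $\mathrm L=\bar{\mathrm L}\mathrm U^{-\top}$ are such that the closed loop formed by the plant $$x_p(k+1)=\mathrm A_px_p(k)+\mathrm B_pu(k),\qquad y(k)=x_p(k-d(k)),$$ and the observer-controller $$\hat x_p(k+1)=\mathrm A_p\hat x_p(k)+\mathrm B_pu(k)+\mathrm Le_y(k),\qquad u(k)=\mathrm K\hat x_p(k)+\mathrm Fe_y(k),\qquad e_y(k)=y(k)-\hat x_p(k-d_n),$$ that is, the system $$x(k+1)=\mathrm Ax(k)+\mathrm A_nx(k-d_n)+\mathrm A_dx(k-d(k)),\ k\ge0,\qquad x(k)=\phi(k),\ k\in[-d_M,0],$$ with $x(k)=[x_p(k)^\top\ e(k)^\top]^\top\in\mathbb R^n$, $e(k)=x_p(k)-\hat x_p(k)$, and $$\mathrm A=\begin{bmatrix}\mathrm A_p+\mathrm B_p\mathrm K&-\mathrm B_p\mathrm K\\0&\mathrm A_p\end{bmatrix},\quad \mathrm A_d=\begin{bmatrix}\mathrm B_p\mathrm F&0\\-\mathrm L&0\end{bmatrix},\quad \mathrm A_n=\begin{bmatrix}-\mathrm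 B_p\mathrm F&\mathrm B_p\mathrm F\\\mathrm L&-\mathrm L\end{bmatrix},$$ is asymptotically stable for any time-varying delay $d:\mathbb N\to[d_m,d_M]$.
   Context: Notation: $\mathbb S_m^+$ is the set of symmetric positive definite $m\times m$ real matrices; $\prec,\succ$ denote the definiteness order on symmetric matrices; $\mathrm{He}\{Y\}=Y+Y^\top$; $\mathrm{diag}$ denotes block-diagonal matrices; $\mathrm I$ and $0$ are identity and zero matrices ($n\times n$ when the size is not indicated), $0_n$ is the $n\times n$ zero matrix; $\star$ denotes the block determined by symmetry. $d(k)$ is an integer delay, $d_m\le d(k)\le d_M$. Scalars: $d_{m_1}=d_m$, $d_{M_1}=d_n$, $d_{m_2}=d_n$, $d_{M_2}=d_M$; $d_{\Delta_j}=d_{M_j}-d_{m_j}$, $d_{\Delta_M}=d_M-d_{M_1}=d_M-d_n$; $\gamma(1)=1$, $\gamma(d)=(d+1)/(d-1)$ for $d>1$. Matrices containing the design variables: $$\bar{\mathrm A}=\begin{bmatrix}\mathrm A_p\mathrm U^\top+\mathrm B_p\bar{\mathrm K}&-\mathrm B_p\bar{\mathrm K}\\0&\mathrm A_p\mathrm U^\top\end{bmatrix},\quad \bar{\mathrm A}_d=\begin{bmatrix}\mathrm B_p\bar{\mathrm F}&0\\-\bar{\mathrm L}&0\end{bmatrix},\quad \bar{\mathrm A}_n=\begin{bmatrix}-\mathrm B_p\bar{\mathrm F}&\mathrm B_p\bar{\mathrm F}\\\bar{\mathrm L}&-\bar{\mathrm L}\end{bmatrix},$$ $\bar{\mathrm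 A}_{m_1}=0$, $\bar{\mathrm A}_{M_1}=\bar{\mathrm A}_n$, $\bar{\mathrm A}_{m_2}=\bar{\mathrm A}_n$, $\bar{\mathrm A}_{M_2}=0$; $$\bar\Upsilon_{a_j}=\begin{bmatrix}-\mathrm J-\mathrm J^\top&\bar{\mathrm A}-\varepsilon\mathrm J&\bar{\mathrm A}_{m_j}&\bar{\mathrm A}_d&\bar{\mathrm A}_{M_j}\\ \star&\varepsilon\bar{\mathrm A}+\varepsilon\bar{\mathrm A}^\top&\varepsilon\bar{\mathrm A}_{m_j}&\varepsilon\bar{\mathrm A}_d&\varepsilon\bar{\mathrm A}_{M_j}\\ \star&\star&0&0&0\\ \star&\star&\star&0&0\\ \star&\star&\star&\star&0\end{bmatrix},$$ $\bar\Upsilon_1=\mathrm{diag}(\bar\Upsilon_{a_1},0_{5n\times5n})$, $\bar\Upsilon_2=\mathrm{diag}(\bar\Upsilon_{a_2},0_{3n\times3n})$. $\mathcal I=[\,\mathrm I\ \ \varepsilon\mathrm I\ \ 0\ \cdots\ 0\,]\in\mathbb R^{n\times(d_M+2)n}$ and, for an integer $l\in[1,d_M]$, $$\bar{\mathcal L}(l)=[\,-\mathrm J^\top\ \ \bar{\mathrm A}\ \ 0\cdots0\ \ \bar{\mathrm A}_n\ \ 0\cdots0\,]+\bar{\mathrm A}_d[\,0\ \ 0\ \ \delta(1)\mathrm I\ \cdots\ \delta(d_M)\mathrm I\,]\in\mathbb R^{n\times(d_M+2)n},$$ where the blocks correspond in order to $x(k+1),x(k),x(k-1),\dots,x(k-d_M)$,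 $\bar{\mathrm A}_n$ is in the block of $x(k-d_n)$, and $\delta(i)=1$ if $i=l$, $\delta(i)=0$ otherwise. Basic constant matrices ($n\times n$ blocks): $$M=\begin{bmatrix}0&\mathrm I&-\mathrm I&0&0&0\\0&\mathrm I&\mathrm I&0&0&-2\mathrm I\end{bmatrix},\quad W_\Psi=\begin{bmatrix}[\,0_{2n\times2n}\ \ M\,]\\ [\,0_{2n\times n}\ \ M\ \ 0_{2n\times n}\,]\end{bmatrix},\quad W_s=[\,M\ \ 0_{2n\times2n}\,],\quad W_3=[\,\mathrm I\ -\mathrm I\ 0\ 0\ 0\ 0\ 0\ 0\,],$$ $$W_1(a,b)=\begin{bmatrix}0&\mathrm I&0&0&0&0&0&0\\0&-\mathrm I&0&0&0&(a+1)\mathrm I&0&0\\0&0&-\mathrm I&-\mathrm I&0&0&(1-a)\mathrm I&(b+1)\mathrm I\end{bmatrix},$$ $$W_2(a,b)=\begin{bmatrix}\mathrm I&0&0&0&0&0&0&0\\0&0&-\mathrm I&0&0&(a+1)\mathrm I&0&0\\0&0&0&-\mathrm I&-\mathrm I&0&(1-a)\mathrm I&(b+1)\mathrm I\end{bmatrix},\quad W(d)=\begin{bmatrix}0_{2n\times8n}\\ [\,0_{n\times6n}\ \ d\,\mathrm I\ \ -d\,\mathrm I\,]\end{bmatrix}.$$ For $j=2$: $W_{\Psi_2}=W_\Psi$, $W_{s_2}=W_s$, $W_{3_2}=W_3$, $W_{1_2}=W_1(d_{m_2},d_{M_2})$, $W_{2_2}=W_2(d_{m_2},d_{M_2})$,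 $W_2(d)=W(d)$ (the symbol $W_j(d)$ with the single argument $d$). For $j=1$: $W_{\Psi_1}=[\,W_\Psi\ \ 0_{4n\times2n}\,]$, $W_{s_1}=[\,W_s\ \ 0_{2n\times2n}\,]$, $W_{3_1}=[\,W_3\ \ 0_{n\times2n}\,]$, $$W_{1_1}=\begin{bmatrix}[\,W_1(d_{m_1},d_{M_1})\ \ 0_{3n\times2n}\,]\\ [\,0_{n\times4n}\ -\mathrm I\ \ 0_{n\times4n}\ \ (d_{\Delta_M}+1)\mathrm I\,]\end{bmatrix},\quad W_{2_1}=\begin{bmatrix}[\,W_2(d_{m_1},d_{M_1})\ \ 0_{3n\times2n}\,]\\ [\,0_{n\times8n}\ -\mathrm I\ \ (d_{\Delta_M}+1)\mathrm I\,]\end{bmatrix},$$ $$W_1(d)=\begin{bmatrix}[\,W(d)\ \ 0_{3n\times2n}\,]\\ 0_{n\times10n}\end{bmatrix},\quad W_z=\begin{bmatrix}0_{n\times4n}&\mathrm I&0_{n\times3n}&-\mathrm I&0\\0_{n\times4n}&\mathrm I&0_{n\times3n}&\mathrm I&-2\mathrm I\end{bmatrix}.$$ Matrices of the first conditions: $\bar\Psi_{z_j}=\begin{bmatrix}\bar{\mathscr Z}_{2_j}&\bar{\mathrm X}_j\\ \star&\bar{\mathscr Z}_{2_j}\end{bmatrix}$, $\bar{\mathscr Z}_{1_j}=\mathrm{diag}(\bar{\mathrm Z}_{1_j},3\gamma(d_{m_j})\bar{\mathrm Z}_{1_j})$, $\bar{\mathscr Z}_{2_j}=\mathrm{diag}(\bar{\mathrm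 Z}_{2_j},3\bar{\mathrm Z}_{2_j})$, $\bar{\mathscr Z}_{3_1}=\mathrm{diag}(\bar{\mathrm Z}_{3_1},3\bar{\mathrm Z}_{3_1})$, $\bar{\mathcal Q}_1=\mathrm{diag}(0,\bar{\mathrm Q}_{1_1},\bar{\mathrm Q}_{2_1}-\bar{\mathrm Q}_{1_1},0,\bar{\mathrm Q}_{3_1}-\bar{\mathrm Q}_{2_1},0_{5n\times5n})$, $\bar{\mathcal Q}_2=\mathrm{diag}(0,\bar{\mathrm Q}_{1_2},\bar{\mathrm Q}_{2_2}-\bar{\mathrm Q}_{1_2},0,-\bar{\mathrm Q}_{2_2},0_{3n\times3n})$, $$\bar\Phi(d,j)=W_{2_j}^\top\bar{\mathrm P}_jW_{2_j}-W_{1_j}^\top\bar{\mathrm P}_jW_{1_j}+\mathrm{He}\{W_j(d)^\top\bar{\mathrm P}_j(W_{2_j}-W_{1_j})\}+\bar{\mathcal Q}_j+\bar\Phi_3(j),$$ $$\bar\Phi_3(1)=W_{3_1}^\top(d_{m_1}^2\bar{\mathrm Z}_{1_1}+d_{\Delta_1}^2\bar{\mathrm Z}_{2_1}+d_{\Delta_M}^2\bar{\mathrm Z}_{3_1})W_{3_1}-W_{s_1}^\top\bar{\mathscr Z}_{1_1}W_{s_1}-W_{\Psi_1}^\top\bar\Psi_{z_1}W_{\Psi_1}-W_z^\top\bar{\mathscr Z}_{3_1}W_z,$$ $$\bar\Phi_3(2)=W_{3_2}^\top(d_{m_2}^2\bar{\mathrm Z}_{1_2}+d_{\Delta_2}^2\bar{\mathrm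 Z}_{2_2})W_{3_2}-W_{s_2}^\top\bar{\mathscr Z}_{1_2}W_{s_2}-W_{\Psi_2}^\top\bar\Psi_{z_2}W_{\Psi_2}.$$ Matrices of the last two conditions: $\bar{\mathrm S}_j=W_{5_j}^\top\bar{\mathrm P}_jW_{5_j}+\bar{\mathcal P}_j$. $W_{5_j}$ has $d_M+1$ block columns numbered $0,\dots,d_M$. Its first block row has $\mathrm I$ in block $0$ and zeros elsewhere; its second has $\mathrm I$ in blocks $1,\dots,d_{m_j}$ and zeros elsewhere; its third has $\mathrm I$ in blocks $d_{m_j}+1,\dots,d_{M_j}$ and zeros elsewhere; for $j=1$ only, there is a fourth block row with $\mathrm I$ in blocks $d_{M_1}+1,\dots,d_M$ and zeros elsewhere. $\bar{\mathcal P}_1=\mathrm{diag}(\bar{\mathcal H}_1,\bar{\mathrm Q}_{3_1},\dots,\bar{\mathrm Q}_{3_1})+\bar{\mathcal H}_a$ with $d_M-d_{M_1}$ copies of $\bar{\mathrm Q}_{3_1}$, and $\bar{\mathcal P}_2=\bar{\mathcal H}_2$. Here $\bar{\mathcal H}_j$ is the symmetric block tridiagonal matrix with block rows and columns $0,\dots,d_{M_j}$ whose diagonal blocks are, in order, $\mathcal P_0,\mathcal P_{a_1},\dots,\mathcal P_{a_{d_{m_j}}},\mathcal P_{c_1},\dots,\mathcal P_{c_{d_{\Delta_j}}}$ and whose superdiagonal blocks are, in order, $\mathcal P_{b_1},\dots,\mathcal P_{b_{d_{m_j}}},\mathcal P_{d_1},\dots,\mathcal P_{d_{d_{\Delta_j}}}$,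 with $\mathcal P_0=\bar{\mathrm Z}_{1_j}d_{m_j}^2+\bar{\mathrm Z}_{2_j}d_{\Delta_j}^2$, $\mathcal P_{a_i}=\bar{\mathrm Q}_{1_j}+2\bar{\mathrm Z}_{2_j}d_{\Delta_j}^2+\bar{\mathrm Z}_{1_j}d_{m_j}(2d_{m_j}-2i+1)$, $\mathcal P_{b_i}=-\bar{\mathrm Z}_{2_j}d_{\Delta_j}^2-\bar{\mathrm Z}_{1_j}d_{m_j}(d_{m_j}-i+1)$, $\mathcal P_{c_l}=\bar{\mathrm Q}_{2_j}+\bar{\mathrm Z}_{2_j}d_{\Delta_j}(2d_{\Delta_j}-2l+1)$, $\mathcal P_{d_l}=-\bar{\mathrm Z}_{2_j}d_{\Delta_j}(d_{\Delta_j}-l+1)$, for $i\in[1,d_{m_j}]$, $l\in[1,d_{\Delta_j}]$. $\bar{\mathcal H}_a$ is the symmetric block tridiagonal matrix with block rows and columns $0,\dots,d_M$, with diagonal blocks $\mathcal P_0,\mathcal P_{a_1},\dots,\mathcal P_{a_{d_{M_1}}},\mathcal P_{c_1},\dots,\mathcal P_{c_{d_{\Delta_M}}}$ and superdiagonal blocks $\mathcal P_{b_1},\dots,\mathcal P_{b_{d_{M_1}}},\mathcal P_{d_1},\dots,\mathcal P_{d_{d_{\Delta_M}}}$, where now $\mathcal P_0=\bar{\mathrm Z}_{3_1}d_{\Delta_M}^2$, $\mathcal P_{a_i}=2\bar{\mathrm Z}_{3_1}d_{\Delta_M}^2$, $\mathcal P_{b_i}=-\bar{\mathrm Z}_{3_1}d_{\Delta_M}^2$,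 $\mathcal P_{c_l}=\bar{\mathrm Z}_{3_1}d_{\Delta_M}(2d_{\Delta_M}-2l+1)$, $\mathcal P_{d_l}=-\bar{\mathrm Z}_{3_1}d_{\Delta_M}(d_{\Delta_M}-l+1)$. *)

(* Defs.v *)
From HB Require Import structures.
From mathcomp Require Import all_boot all_order all_algebra.
From mathcomp Require Import all_classical all_reals all_analysis.

Set Implicit Arguments.
Unset Strict Implicit.
Unset Printing Implicit Defensive.

Import Order.TTheory GRing.Theory Num.Theory.
Import numFieldNormedType.Exports.
Local Open Scope classical_set_scope.
Local Open Scope ring_scope.

(* Definiteness order on real symmetric matrices *)

Definition posdefmx (R : realType) (n : nat) (A : 'M[R]_n) : Prop :=
  A^T = A /\ forall v : 'cV[R]_n, v != 0 -> 0 < (v^T *m A *m v) ord0 ord0.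

Definition negdefmx (R : realType) (n : nat) (A : 'M[R]_n) : Prop :=
  posdefmx (- A).

Definition mxHe (R : realType) (n : nat) (Y : 'M[R]_n) : 'M[R]_n := Y + Y^T.

(* Block matrices with n x n blocks.  A matrix with p x q such blocks lives in
   the type of the library's \mxblock, 'M_(bsize p n, bsize q n); bsize p n is
   equal to p * n, but not convertible to it. *)

Notation bsize p n := (\sum_(i < p) n)%N.

(* The Kronecker product of a table of scalars (given by its rows) with I_n;
   missing entries count as 0. *)
Definition cblock (R : realType) (n p q : nat) (T : seq (seq R)) :
    'M[R]_(bsize p n, bsize q n) :=
  \mxblock_(i < p, j < q) (((nth [::] T i)`_j)%:M : 'M[R]_n).
Arguments cblock {R n p q} T.

Definition crow (R : realType) (n q : nat) (t : seq R) : 'M[R]_(n, bsize q n) :=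
  \mxrow_(j < q) ((t`_j)%:M : 'M[R]_n).
Arguments crow {R n q} t.

Definition padl (R : realType) (k : nat) (T : seq (seq R)) : seq (seq R) :=
  [seq nseq k 0 ++ r | r <- T].
Definition padr (R : realType) (k : nat) (T : seq (seq R)) : seq (seq R) :=
  [seq r ++ nseq k 0 | r <- T].

Definition bdiag (R : realType) (n p : nat) (s : seq 'M[R]_n) :
    'M[R]_(bsize p n) :=
  \mxdiag_(i < p) s`_i.
Arguments bdiag {R n p} s.

(* The i-th element of s lists the blocks (i, i), (i, i + 1), ... of row i; the
   blocks below the diagonal are determined by symmetry. *)
Definition bsym (R : realType) (n p : nat) (s : seq (seq 'M[R]_n)) :
    'M[R]_(bsize p n) :=
  \mxblock_(i < p, j < p)
    (if (i <= j)%N then (nth [::] s i)`_(j - i)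
     else ((nth [::] s j)`_(i - j))^T).
Arguments bsym {R n p} s.

(* Symmetric block tridiagonal matrix with diagonal blocks D and superdiagonal
   blocks E, both listed in order. *)
Definition btridiag (R : realType) (n p : nat) (D E : seq 'M[R]_n) :
    'M[R]_(bsize p n) :=
  \mxblock_(i < p, j < p)
    (if (i == j :> nat) then D`_i
     else if (j == i.+1 :> nat) then E`_i
     else if (i == j.+1 :> nat) then (E`_j)^T
     else 0).
Arguments btridiag {R n p} D E.

Definition getblock (R : realType) (n p : nat) (A : 'M[R]_(bsize p n))
    (i j : nat) : 'M[R]_n :=
  match insub i, insub j with
  | Some i', Some j' => submxblock A i' j'
  | _, _ => 0
  end.

(* diag(A, B).  The number r of blocks of the result is a separate parameter, to
   be used only with r equal to p + q; this avoids casts between the types for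
   provably equal numbers of blocks such as p + 1 and p.+1. *)
Definition bdiag2 (R : realType) (n p q r : nat)
    (A : 'M[R]_(bsize p n)) (B : 'M[R]_(bsize q n)) : 'M[R]_(bsize r n) :=
  \mxblock_(i < r, j < r)
    (getblock A i j +
     (if (p <= i)%N && (p <= j)%N then getblock B (i - p) (j - p) else 0)).
Arguments bdiag2 {R n p q r} A B.

(* Constant matrices *)

Definition gammaw (R : realType) (d : nat) : R :=
  if d == 1%N then 1 else (d%:R + 1) / (d%:R - 1).

Definition Mtab (R : realType) : seq (seq R) :=
  [:: [:: 0; 1; -1; 0; 0;  0];
      [:: 0; 1;  1; 0; 0; -2]].

Definition W1tab (R : realType) (a b : nat) : seq (seq R) :=
  [:: [:: 0;  1;  0;  0; 0;         0;         0;         0];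
      [:: 0; -1;  0;  0; 0; a%:R + 1;         0;         0];
      [:: 0;  0; -1; -1; 0;         0; 1 - a%:R; b%:R + 1]].

Definition W2tab (R : realType) (a b : nat) : seq (seq R) :=
  [:: [:: 1; 0;  0;  0;  0;         0;         0;         0];
      [:: 0; 0; -1;  0;  0; a%:R + 1;         0;         0];
      [:: 0; 0;  0; -1; -1;         0; 1 - a%:R; b%:R + 1]].

Definition Wdtab (R : realType) (d : nat) : seq (seq R) :=
  [:: nseq 8 0; nseq 8 0; nseq 6 0 ++ [:: d%:R; - d%:R]].

Definition W3row (R : realType) : seq R := [:: 1; -1; 0; 0; 0; 0; 0; 0].

(* In all names below the last digit is the index j of the interval:
   [dm, dn] for j = 1 and [dn, dM] for j = 2.  W1_1 is W_{1_1}, Z21 is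
   Z_{2_1}, and so on; Wd_j is W_j(d), and dDM is dM - dn. *)

Definition WPsi_2 (R : realType) (n : nat) :
    'M[R]_(bsize 2 n + bsize 2 n, bsize 8 n) :=
  col_mx (cblock (padl 2 (Mtab R))) (cblock (padr 1 (padl 1 (Mtab R)))).
Definition Ws_2 (R : realType) (n : nat) : 'M[R]_(bsize 2 n, bsize 8 n) :=
  cblock (padr 2 (Mtab R)).
Definition W3_2 (R : realType) (n : nat) : 'M[R]_(n, bsize 8 n) :=
  crow (W3row R).
Definition W1_2 (R : realType) (n dn dM : nat) : 'M[R]_(bsize 3 n, bsize 8 n) :=
  cblock (W1tab R dn dM).
Definition W2_2 (R : realType) (n dn dM : nat) : 'M[R]_(bsize 3 n, bsize 8 n) :=
  cblock (W2tab R dn dM).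
Definition Wd_2 (R : realType) (n d : nat) : 'M[R]_(bsize 3 n, bsize 8 n) :=
  cblock (Wdtab R d).

Definition WPsi_1 (R : realType) (n : nat) :
    'M[R]_(bsize 2 n + bsize 2 n, bsize 10 n) :=
  col_mx (cblock (padr 2 (padl 2 (Mtab R))))
         (cblock (padr 2 (padr 1 (padl 1 (Mtab R))))).
Definition Ws_1 (R : realType) (n : nat) : 'M[R]_(bsize 2 n, bsize 10 n) :=
  cblock (padr 2 (padr 2 (Mtab R))).
Definition W3_1 (R : realType) (n : nat) : 'M[R]_(n, bsize 10 n) :=
  crow (W3row R ++ nseq 2 0).
Definition W1_1 (R : realType) (n dm dn dM : nat) :
    'M[R]_(bsize 4 n, bsize 10 n) :=
  let dDM := (dM - dn)%N in
  cblock (padr 2 (W1tab R dm dn) ++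
          [:: nseq 4 0 ++ [:: -1] ++ nseq 4 0 ++ [:: dDM%:R + 1]]).
Definition W2_1 (R : realType) (n dm dn dM : nat) :
    'M[R]_(bsize 4 n, bsize 10 n) :=
  let dDM := (dM - dn)%N in
  cblock (padr 2 (W2tab R dm dn) ++
          [:: nseq 8 0 ++ [:: -1; dDM%:R + 1]]).
Definition Wd_1 (R : realType) (n d : nat) : 'M[R]_(bsize 4 n, bsize 10 n) :=
  cblock (padr 2 (Wdtab R d) ++ [:: nseq 10 0]).
Definition Wz (R : realType) (n : nat) : 'M[R]_(bsize 2 n, bsize 10 n) :=
  cblock [:: nseq 4 0 ++ [:: 1] ++ nseq 3 0 ++ [:: -1;  0];
             nseq 4 0 ++ [:: 1] ++ nseq 3 0 ++ [::  1; -2]].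

(* Conditions at the end points of the two delay intervals *)

Definition Zcal1 (R : realType) (n dm : nat) (Z1 : 'M[R]_n) :
    'M[R]_(bsize 2 n) :=
  bdiag [:: Z1; (3 * gammaw R dm) *: Z1].

(* Both Zcal_{2_j} (applied to Z_{2_j}) and Zcal_{3_1} (applied to Z_{3_1}). *)
Definition Zcal (R : realType) (n : nat) (Z : 'M[R]_n) : 'M[R]_(bsize 2 n) :=
  bdiag [:: Z; 3 *: Z].

Definition Psiz (R : realType) (n : nat) (Z2 : 'M[R]_n)
    (X : 'M[R]_(bsize 2 n)) : 'M[R]_(bsize 2 n + bsize 2 n) :=
  block_mx (Zcal Z2) X X^T (Zcal Z2).

Definition Qcal_1 (R : realType) (n : nat) (Q11 Q21 Q31 : 'M[R]_n) :
    'M[R]_(bsize 10 n) :=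
  bdiag ([:: 0; Q11; Q21 - Q11; 0; Q31 - Q21] ++ nseq 5 0).
Definition Qcal_2 (R : realType) (n : nat) (Q12 Q22 : 'M[R]_n) :
    'M[R]_(bsize 8 n) :=
  bdiag ([:: 0; Q12; Q22 - Q12; 0; - Q22] ++ nseq 3 0).

Definition Phi3_1 (R : realType) (n dm dn dM : nat) (Z11 Z21 Z31 : 'M[R]_n)
    (X1 : 'M[R]_(bsize 2 n)) : 'M[R]_(bsize 10 n) :=
  let dD1 := (dn - dm)%N in
  let dDM := (dM - dn)%N in
  let W3 := W3_1 R n in
  let Ws := Ws_1 R n in
  let WPsi := WPsi_1 R n in
  W3^T *m (dm%:R ^+ 2 *: Z11 + dD1%:R ^+ 2 *: Z21 + dDM%:R ^+ 2 *: Z31) *m W3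
  - Ws^T *m Zcal1 dm Z11 *m Ws
  - WPsi^T *m Psiz Z21 X1 *m WPsi
  - (Wz R n)^T *m Zcal Z31 *m Wz R n.

Definition Phi3_2 (R : realType) (n dn dM : nat) (Z12 Z22 : 'M[R]_n)
    (X2 : 'M[R]_(bsize 2 n)) : 'M[R]_(bsize 8 n) :=
  let dD2 := (dM - dn)%N in
  let W3 := W3_2 R n in
  let Ws := Ws_2 R n in
  let WPsi := WPsi_2 R n in
  W3^T *m (dn%:R ^+ 2 *: Z12 + dD2%:R ^+ 2 *: Z22) *m W3
  - Ws^T *m Zcal1 dn Z12 *m Ws
  - WPsi^T *m Psiz Z22 X2 *m WPsi.

Definition Phi_1 (R : realType) (n dm dn dM : nat) (P1 : 'M[R]_(bsize 4 n))
    (Q11 Q21 Q31 Z11 Z21 Z31 : 'M[R]_n) (X1 : 'M[R]_(bsize 2 n)) (d : nat) :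
    'M[R]_(bsize 10 n) :=
  let W1 := W1_1 R n dm dn dM in
  let W2 := W2_1 R n dm dn dM in
  W2^T *m P1 *m W2 - W1^T *m P1 *m W1
  + mxHe ((Wd_1 R n d)^T *m P1 *m (W2 - W1))
  + Qcal_1 Q11 Q21 Q31 + Phi3_1 dm dn dM Z11 Z21 Z31 X1.

Definition Phi_2 (R : realType) (n dn dM : nat) (P2 : 'M[R]_(bsize 3 n))
    (Q12 Q22 Z12 Z22 : 'M[R]_n) (X2 : 'M[R]_(bsize 2 n)) (d : nat) :
    'M[R]_(bsize 8 n) :=
  let W1 := W1_2 R n dn dM in
  let W2 := W2_2 R n dn dM in
  W2^T *m P2 *m W2 - W1^T *m P2 *m W1
  + mxHe ((Wd_2 R n d)^T *m P2 *m (W2 - W1))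
  + Qcal_2 Q12 Q22 + Phi3_2 dn dM Z12 Z22 X2.

Definition Ups_a (R : realType) (n : nat) (eps : R) (J A Am Ad AM : 'M[R]_n) :
    'M[R]_(bsize 5 n) :=
  bsym [:: [:: - J - J^T; A - eps *: J; Am; Ad; AM];
           [:: eps *: A + eps *: A^T; eps *: Am; eps *: Ad; eps *: AM];
           [:: 0; 0; 0];
           [:: 0; 0];
           [:: 0]].

Definition Ups_1 (R : realType) (n : nat) (eps : R) (J A An Ad : 'M[R]_n) :
    'M[R]_(bsize 10 n) :=
  bdiag2 (Ups_a eps J A 0 Ad An) (0 : 'M[R]_(bsize 5 n)).
Definition Ups_2 (R : realType) (n : nat) (eps : R) (J A An Ad : 'M[R]_n) :
    'M[R]_(bsize 8 n) :=
  bdiag2 (Ups_a eps J A An Ad 0) (0 : 'M[R]_(bsize 3 n)).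

(* Switching conditions *)

Definition W5_1 (R : realType) (n dm dn dM : nat) :
    'M[R]_(bsize 4 n, bsize dM.+1 n) :=
  \mxblock_(i < 4, c < dM.+1)
    ((nth false [:: c == 0%N :> nat; (1 <= c <= dm)%N; (dm.+1 <= c <= dn)%N;
                    (dn.+1 <= c <= dM)%N] i)%:R%:M : 'M[R]_n).
Definition W5_2 (R : realType) (n dn dM : nat) :
    'M[R]_(bsize 3 n, bsize dM.+1 n) :=
  \mxblock_(i < 3, c < dM.+1)
    ((nth false [:: c == 0%N :> nat; (1 <= c <= dn)%N;
                    (dn.+1 <= c <= dM)%N] i)%:R%:M : 'M[R]_n).

(* Hcal_j, with [a, b] the delay interval of index j. *)
Definition Hcal (R : realType) (n a b : nat) (Q1 Q2 Z1 Z2 : 'M[R]_n) :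
    'M[R]_(bsize b.+1 n) :=
  let dD := (b - a)%N in
  let ar : R := a%:R in
  let dr : R := dD%:R in
  let P0 := ar ^+ 2 *: Z1 + dr ^+ 2 *: Z2 in
  let Pa i := Q1 + (2 * dr ^+ 2) *: Z2 + (ar * (2 * ar - 2 * i%:R + 1)) *: Z1 in
  let Pb i := - (dr ^+ 2 *: Z2) - (ar * (ar - i%:R + 1)) *: Z1 in
  let Pc l := Q2 + (dr * (2 * dr - 2 * l%:R + 1)) *: Z2 in
  let Pd l := - ((dr * (dr - l%:R + 1)) *: Z2) in
  btridiag
    (P0 :: [seq Pa i | i <- iota 1 a] ++ [seq Pc l | l <- iota 1 dD])
    ([seq Pb i | i <- iota 1 a] ++ [seq Pd l | l <- iota 1 dD]).

Definition Hcal_a (R : realType) (n dn dM : nat) (Z31 : 'M[R]_n) :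
    'M[R]_(bsize dM.+1 n) :=
  let dDM := (dM - dn)%N in
  let dr : R := dDM%:R in
  let P0 := dr ^+ 2 *: Z31 in
  let Pa := (2 * dr ^+ 2) *: Z31 in
  let Pb := - (dr ^+ 2 *: Z31) in
  let Pc l := (dr * (2 * dr - 2 * l%:R + 1)) *: Z31 in
  let Pd l := - ((dr * (dr - l%:R + 1)) *: Z31) in
  btridiag
    (P0 :: nseq dn Pa ++ [seq Pc l | l <- iota 1 dDM])
    (nseq dn Pb ++ [seq Pd l | l <- iota 1 dDM]).

Definition Pcal_1 (R : realType) (n dm dn dM : nat)
    (Q11 Q21 Q31 Z11 Z21 Z31 : 'M[R]_n) : 'M[R]_(bsize dM.+1 n) :=
  bdiag2 (Hcal dm dn Q11 Q21 Z11 Z21)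
         (bdiag (nseq (dM - dn) Q31) : 'M[R]_(bsize (dM - dn) n))
  + Hcal_a dn dM Z31.

Definition Sbar_1 (R : realType) (n dm dn dM : nat) (P1 : 'M[R]_(bsize 4 n))
    (Q11 Q21 Q31 Z11 Z21 Z31 : 'M[R]_n) : 'M[R]_(bsize dM.+1 n) :=
  let W5 := W5_1 R n dm dn dM in
  W5^T *m P1 *m W5 + Pcal_1 dm dn dM Q11 Q21 Q31 Z11 Z21 Z31.

Definition Sbar_2 (R : realType) (n dn dM : nat) (P2 : 'M[R]_(bsize 3 n))
    (Q12 Q22 Z12 Z22 : 'M[R]_n) : 'M[R]_(bsize dM.+1 n) :=
  let W5 := W5_2 R n dn dM in
  W5^T *m P2 *m W5 + Hcal dn dM Q12 Q22 Z12 Z22.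

Definition Ical (R : realType) (n dM : nat) (eps : R) :
    'M[R]_(n, bsize dM.+2 n) :=
  crow [:: 1; eps].
Arguments Ical {R} n dM eps.

(* The block columns 0, 1, 2, ..., dM + 1 correspond to
   x(k + 1), x(k), x(k - 1), ..., x(k - dM), so x(k - i) is at i + 1. *)
Definition Lcal (R : realType) (n dn dM : nat) (J A An Ad : 'M[R]_n)
    (l : nat) : 'M[R]_(n, bsize dM.+2 n) :=
  \mxrow_(c < dM.+2)
    (if c == 0%N :> nat then - J^T
     else if c == 1%N :> nat then A
     else if c == dn.+1 :> nat then An
     else 0)
  + Ad *m crow ([:: 0; 0] ++ [seq (i == l)%:R | i <- iota 1 dM]).

(* Plant, observer-controller and closed loop *)

Fixpoint plant_state (R : realType) (n m : nat) (A : 'M[R]_n)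
    (B : 'M[R]_(n, m)) (u : nat -> 'cV[R]_m) (x0 : 'cV[R]_n) (k : nat) :
    'cV[R]_n :=
  if k is k'.+1 then A *m plant_state A B u x0 k' + B *m u k' else x0.

Definition controllable (R : realType) (n m : nat) (A : 'M[R]_n)
    (B : 'M[R]_(n, m)) : Prop :=
  forall x0 x1 : 'cV[R]_n,
    exists (N : nat) (u : nat -> 'cV[R]_m), plant_state A B u x0 N = x1.

Definition closed_loop (R : realType) (np m : nat) (Ap : 'M[R]_np)
    (Bp : 'M[R]_(np, m)) (K F : 'M[R]_(m, np)) (L : 'M[R]_np) (dn : nat)
    (d : nat -> nat) (xp xh : int -> 'cV[R]_np) : Prop :=
  exists (u : nat -> 'cV[R]_m) (y ey : nat -> 'cV[R]_np), forall k : nat,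
    [/\ xp k.+1%:Z = Ap *m xp k%:Z + Bp *m u k,
        y k = xp (k%:Z - (d k)%:Z),
        xh k.+1%:Z = Ap *m xh k%:Z + Bp *m u k + L *m ey k,
        u k = K *m xh k%:Z + F *m ey k
      & ey k = y k - xh (k%:Z - dn%:Z)].

Definition delay_system (R : realType) (n : nat) (A An Ad : 'M[R]_n) (dn : nat)
    (d : nat -> nat) (x : int -> 'cV[R]_n) : Prop :=
  forall k : nat,
    x k.+1%:Z = A *m x k%:Z + An *m x (k%:Z - dn%:Z)
                + Ad *m x (k%:Z - (d k)%:Z).

Definition solution (R : realType) (n : nat) (A An Ad : 'M[R]_n) (dn dM : nat)
    (d : nat -> nat) (phi x : int -> 'cV[R]_n) : Prop :=
  delay_system A An Ad dn d x /\
  forall k : int, - dM%:Z <= k <= 0 -> x k = phi k.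

(* Lyapunov stability of the zero solution together with attractivity, which
   is global since the system is linear. *)
Definition asymptotically_stable (R : realType) (n : nat) (A An Ad : 'M[R]_n)
    (dn dM : nat) (d : nat -> nat) : Prop :=
  (forall e : R, 0 < e -> exists2 delta : R, 0 < delta &
     forall phi x : int -> 'cV[R]_n, solution A An Ad dn dM d phi x ->
       (forall k : int, - dM%:Z <= k <= 0 -> `|phi k| < delta) ->
       forall k : nat, `|x k%:Z| < e) /\
  (forall phi x : int -> 'cV[R]_n, solution A An Ad dn dM d phi x ->
     (fun k : nat => x k%:Z) @ \oo --> (0 : 'cV[R]_n)).

Definition Acl (R : realType) (np m : nat) (Ap : 'M[R]_np) (Bp : 'M[R]_(np, m))
    (K : 'M[R]_(m, np)) : 'M[R]_(np + np) :=
  block_mx (Ap + Bp *m K) (- (Bp *m K)) 0 Ap.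

Definition Abar (R : realType) (np m : nat) (Ap : 'M[R]_np) (Bp : 'M[R]_(np, m))
    (U : 'M[R]_np) (Kb : 'M[R]_(m, np)) : 'M[R]_(np + np) :=
  block_mx (Ap *m U^T + Bp *m Kb) (- (Bp *m Kb)) 0 (Ap *m U^T).

(* A_d and A_n at the gains F and L; \bar A_d and \bar A_n at \bar F and
   \bar L. *)
Definition Admx (R : realType) (np m : nat) (Bp : 'M[R]_(np, m))
    (F : 'M[R]_(m, np)) (L : 'M[R]_np) : 'M[R]_(np + np) :=
  block_mx (Bp *m F) 0 (- L) 0.
Definition Anmx (R : realType) (np m : nat) (Bp : 'M[R]_(np, m))
    (F : 'M[R]_(m, np)) (L : 'M[R]_np) : 'M[R]_(np + np) :=
  block_mx (- (Bp *m F)) (Bp *m F) L (- L).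

(* Main.v *)
Require Import Defs.
From HB Require Import structures.
From mathcomp Require Import all_boot all_order all_algebra.
From mathcomp Require Import all_classical all_reals all_analysis.
From mathcomp Require Import ring lra zify.

Set Implicit Arguments.
Unset Strict Implicit.
Unset Printing Implicit Defensive.

Import Order.TTheory GRing.Theory Num.Theory.
Import numFieldNormedType.Exports.
Local Open Scope classical_set_scope.
Local Open Scope ring_scope.

(** With [x = J^T xi] the closed loop becomes the constraint
    [- J^T xi(k + 1) + Ab xi(k) + Anb xi(k - dn) + Adb xi(k - d(k)) = 0] on the
    bar matrices, so that every condition can be read as a quadratic form in
    [xi] without transforming matrices.  [S_1] and [S_2] are the matrices of two
    Lyapunov-Krasovskii functionals [V_1] and [V_2].  If the delay at time [k]
    is in interval [j], the end point conditions (extended by affinity in the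
    delay, and combined with a discrete Wirtinger inequality and reciprocal
    convexity) bound [V_j(k + 1) - V_j(k)] by [- c |xi(k)|^2], and the switching
    conditions bound the difference of [V_j(k + 1)] and the other functional at
    time [k] likewise.  Hence [min(V_1, V_2)] decreases along every solution.
    The switching condition at a vector [(v, 0, ..., 0)] with [J^T v = 0] shows
    that [U] is invertible. *)

(** * Bilinear forms of real matrices, evaluated at column vectors *)

Section BilinearForms.
Variable R : realType.

Definition bf (m n : nat) (A : 'M[R]_(m, n)) (u : 'cV[R]_m) (v : 'cV[R]_n) :
    R :=
  (u^T *m A *m v) 0 0.

Definition ssq (n : nat) (v : 'cV[R]_n) : R := \sum_i v i 0 ^+ 2.

Variables m n : nat.
Implicit Types (A B : 'M[R]_(m, n)) (u : 'cV[R]_m) (v : 'cV[R]_n).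

Lemma bfDl A u1 u2 v : bf A (u1 + u2) v = bf A u1 v + bf A u2 v.
Proof. by rewrite /bf linearD /= !mulmxDl mxE. Qed.

Lemma bfDr A u v1 v2 : bf A u (v1 + v2) = bf A u v1 + bf A u v2.
Proof. by rewrite /bf mulmxDr mxE. Qed.

Lemma bfNl A u v : bf A (- u) v = - bf A u v.
Proof. by rewrite /bf linearN /= !mulNmx mxE. Qed.

Lemma bfNr A u v : bf A u (- v) = - bf A u v.
Proof. by rewrite /bf mulmxN mxE. Qed.

Lemma bfZl A a u v : bf A (a *: u) v = a * bf A u v.
Proof. by rewrite /bf linearZ /= -!scalemxAl mxE. Qed.

Lemma bfZr A a u v : bf A u (a *: v) = a * bf A u v.
Proof. by rewrite /bf -scalemxAr mxE. Qed.

Lemma bf0l A v : bf A 0 v = 0.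
Proof. by rewrite /bf linear0 !mul0mx mxE. Qed.

Lemma bf0r A u : bf A u 0 = 0.
Proof. by rewrite /bf mulmx0 mxE. Qed.

Lemma bf_suml A I (r : seq I) (P : pred I) (F : I -> 'cV[R]_m) v :
  bf A (\sum_(i <- r | P i) F i) v = \sum_(i <- r | P i) bf A (F i) v.
Proof.
by elim/big_rec2: _ => [|i a b _ <-]; rewrite ?bf0l ?bfDl.
Qed.

Lemma bfDA A B u v : bf (A + B) u v = bf A u v + bf B u v.
Proof. by rewrite /bf mulmxDr mulmxDl mxE. Qed.

Lemma bfNA A u v : bf (- A) u v = - bf A u v.
Proof. by rewrite /bf mulmxN mulNmx mxE. Qed.

Lemma bfZA a A u v : bf (a *: A) u v = a * bf A u v.
Proof. by rewrite /bf -scalemxAr -scalemxAl mxE. Qed.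

Lemma bf0A u v : bf 0 u v = 0.
Proof. by rewrite /bf mulmx0 mul0mx mxE. Qed.

Lemma bf_trmx A u v : bf A^T v u = bf A u v.
Proof.
have -> : bf A u v = (u^T *m A *m v)^T 0 0 by rewrite [RHS]mxE.
by rewrite /bf !trmx_mul trmxK mulmxA.
Qed.

Lemma bf_mulmx p q (W : 'M[R]_(p, m)) (A : 'M[R]_(p, q)) (W' : 'M[R]_(q, n))
    u v :
  bf (W^T *m A *m W') u v = bf A (W *m u) (W' *m v).
Proof. by rewrite /bf trmx_mul !mulmxA. Qed.

Lemma bf_mulmxl p (W : 'M[R]_(p, m)) (A : 'M[R]_(p, n)) u v :
  bf (W^T *m A) u v = bf A (W *m u) v.
Proof. by rewrite /bf trmx_mul !mulmxA. Qed.

Lemma bf_mulmxr p (A : 'M[R]_(m, p)) (W : 'M[R]_(p, n)) u v :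
  bf (A *m W) u v = bf A u (W *m v).
Proof. by rewrite /bf !mulmxA. Qed.

Lemma bf_sum A u v : bf A u v = \sum_i \sum_j u i 0 * A i j * v j 0.
Proof.
rewrite /bf mxE exchange_big /=; apply: eq_bigr => j _.
by rewrite mxE mulr_suml; apply: eq_bigr => i _; rewrite mxE.
Qed.

End BilinearForms.

Notation qf A v := (bf A v v).

(** * Quadratic forms of square matrices and their comparison with the sum of squares *)

Section QuadraticForms.
Variables (R : realType) (n : nat).
Implicit Types (A : 'M[R]_n) (u v : 'cV[R]_n).

Lemma bfC A u v : A^T = A -> bf A u v = bf A v u.
Proof. by move=> AT; rewrite -bf_trmx AT. Qed.

Lemma qfD A u v : A^T = A -> qf A (u + v) = qf A u + 2 * bf A u v + qf A v.
Proof. by move=> AT; rewrite !(bfDl, bfDr) (bfC v u AT); ring. Qed.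

Lemma qfN A u : qf A (- u) = qf A u.
Proof. by rewrite bfNl bfNr opprK. Qed.

Lemma qfB A u v : A^T = A -> qf A (u - v) = qf A u - 2 * bf A u v + qf A v.
Proof. by move=> AT; rewrite qfD // qfN bfNr; ring. Qed.

Lemma qf_mxHe A v : qf (mxHe A) v = 2 * qf A v.
Proof. by rewrite /mxHe bfDA bf_trmx; ring. Qed.

Lemma ssq_qf v : ssq v = qf 1%:M v.
Proof.
rewrite /bf mulmx1 mxE; apply: eq_bigr => i _.
by rewrite mxE expr2.
Qed.

Lemma ssq_ge0 v : 0 <= ssq v.
Proof. by apply: sumr_ge0 => i _; exact: sqr_ge0. Qed.

Lemma posdefmx_ge0 A v : posdefmx A -> 0 <= qf A v.
Proof.
move=> [_ Apos]; have [->|/Apos/ltW//] := eqVneq v 0.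
by rewrite bf0l.
Qed.

Lemma posdefmx_unit A : posdefmx A -> A \in unitmx.
Proof.
move=> [AT Apos]; rewrite -row_free_unit -kermx_eq0.
apply/eqP/row_matrixP => i; rewrite row0; apply/eqP; apply/negP => /negP kNz.
have kA : row i (kermx A) *m A = 0 by apply/sub_kermxP; exact: row_sub.
have /Apos : (row i (kermx A))^T != 0 by rewrite trmx_eq0.
by rewrite trmxK kA mul0mx mxE ltxx.
Qed.

(** At [qf A u *: v - bf A u v *: u] the form equals [qf A u] times the Gram determinant of [u] and
    [v], and it is nonnegative there. *)
Lemma bf_CauchySchwarz A u v : posdefmx A -> bf A u v ^+ 2 <= qf A u * qf A v.
Proof.
move=> Apos; have [->|u0] := eqVneq u 0.
  by rewrite !bf0l expr0n mul0r.
have qu : 0 < qf A u by apply: Apos.2.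
have := posdefmx_ge0 (qf A u *: v - bf A u v *: u) Apos.
rewrite qfB; last exact: Apos.1.
rewrite !(bfZl, bfZr) (bfC v u Apos.1).
set a := qf A u in qu *; set b := bf A u v; set c := qf A v => h.
have : 0 <= a * (a * c - b ^+ 2) by apply: le_trans h _; lra.
by rewrite pmulr_rge0 // subr_ge0.
Qed.

(* Cauchy-Schwarz for [A], applied to [v] and the columns of its inverse,
   replaces compactness of the unit sphere. *)
Lemma posdefmx_coercive A :
  posdefmx A -> exists2 c : R, 0 < c & forall v, c * ssq v <= qf A v.
Proof.
move=> Apos; pose y i := invmx A *m delta_mx i (0 : 'I_1).
pose S := \sum_i qf A (y i).
have S0 : 0 <= S by apply: sumr_ge0 => i _; exact: posdefmx_ge0.
exists (1 + S)^-1; first by rewrite invr_gt0 ltr_wpDr.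
move=> v; rewrite mulrC ler_pdivrMr ?ltr_wpDr //.
have qv := posdefmx_ge0 v Apos.
apply: (@le_trans _ _ (qf A v * S)); last by rewrite ler_wpM2l // lerDr.
rewrite /ssq /S mulr_sumr; apply: ler_sum => i _.
have -> : v i 0 = bf A (y i) v.
  rewrite bfC; last exact: Apos.1.
  rewrite /bf /y -mulmxA mulKVmx ?posdefmx_unit // mxE.
  rewrite (bigD1 i) //= big1 ?addr0 => [|j ji]; rewrite !mxE ?eqxx ?mulr1 //.
  by rewrite (negPf ji) mulr0.
by rewrite mulrC bf_CauchySchwarz.
Qed.

(** Every product [v i 0 * v j 0] is at most [ssq v] in absolute value, so the sum of the absolute
    entries bounds the form; adding 1 keeps the constant positive when that sum is 0. *)
Lemma qf_bounded A : exists2 C : R, 0 < C & forall v, qf A v <= C * ssq v.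
Proof.
pose C := 1 + \sum_i \sum_j `|A i j|; have S0 : 0 <= \sum_i \sum_j `|A i j|.
  by do 2!apply: sumr_ge0 => ? _.
exists C; first by rewrite /C ltr_wpDr.
move=> v; have vi i : v i 0 ^+ 2 <= ssq v.
  by rewrite /ssq (bigD1 i) //= lerDl sumr_ge0 // => j _; exact: sqr_ge0.
apply: (@le_trans _ _ ((\sum_i \sum_j `|A i j|) * ssq v)); last first.
  by rewrite ler_wpM2r ?ssq_ge0 // lerDr.
rewrite bf_sum mulr_suml; apply: ler_sum => i _.
rewrite mulr_suml; apply: ler_sum => j _.
apply: le_trans (ler_norm _) _; rewrite mulrAC normrM mulrC ler_wpM2l //.
have vi1 := vi i; have vj1 := vi j.
have := sqr_ge0 (v i 0 - v j 0); have := sqr_ge0 (v i 0 + v j 0).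
by case: (ler0P (v i 0 * v j 0)) => _; nra.
Qed.

End QuadraticForms.

Lemma ssq_mulmx_bounded (R : realType) m n (M : 'M[R]_(m, n)) :
  exists2 C : R, 0 < C & forall v, ssq (M *m v) <= C * ssq v.
Proof.
have [C C0 hC] := qf_bounded (M^T *m 1%:M *m M).
by exists C => // v; rewrite ssq_qf -bf_mulmx.
Qed.

(** * Block vectors built from sequences, and the action of block matrices on them *)

Section BlockVectors.
Variables (R : realType) (n : nat).
Implicit Types (f g : nat -> 'cV[R]_n).

(** Indexing by all naturals lets one sequence be shifted, truncated or lengthened without ordinals
    or casts. *)
Definition bvec p f : 'cV[R]_(bsize p n) := \mxcol_(i < p) f i.

Lemma eq_bvec p f g : (forall i, (i < p)%N -> f i = g i) -> bvec p f = bvec p g.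
Proof. by move=> fg; apply: eq_mxcol => i; exact: fg. Qed.

Lemma bvecD p f g : bvec p f + bvec p g = bvec p (fun i => f i + g i).
Proof. by rewrite /bvec mxcolD. Qed.

Lemma bvecZ p a f : a *: bvec p f = bvec p (fun i => a *: f i).
Proof. by apply/matrixP => i j; rewrite !mxE. Qed.

Lemma mxblock_bvec p q (B : 'I_p -> 'I_q -> 'M[R]_n) f :
  (\mxblock_(i < p, j < q) B i j) *m bvec q f
  = \mxcol_(i < p) \sum_(j < q) B i j *m f j.
Proof.
rewrite mxblockEv mxcol_mul; apply: eq_mxcol => i.
by rewrite mul_mxrow_mxcol.
Qed.

Lemma mul_tr_mxcol p (F G : 'I_p -> 'cV[R]_n) :
  (\mxcol_i F i)^T *m (\mxcol_i G i) = \sum_i (F i)^T *m G i.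
Proof. by rewrite tr_mxcol mul_mxrow_mxcol. Qed.

Lemma bf_mxblock p q (B : 'I_p -> 'I_q -> 'M[R]_n) f g :
  bf (\mxblock_(i < p, j < q) B i j) (bvec p f) (bvec q g)
  = \sum_(i < p) \sum_(j < q) bf (B i j) (f i) (g j).
Proof.
rewrite {1}/bf -mulmxA mxblock_bvec mul_tr_mxcol summxE.
apply: eq_bigr => i _; rewrite mulmx_sumr summxE.
by apply: eq_bigr => j _; rewrite mulmxA.
Qed.

Lemma cblock_bvec p q (T : seq (seq R)) f :
  cblock T *m bvec q f
  = bvec p (fun i => \sum_(j < q) (nth [::] T i)`_j *: f j).
Proof.
rewrite /cblock mxblock_bvec; apply: eq_mxcol => i.
by apply: eq_bigr => j _; rewrite mul_scalar_mx.
Qed.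

Lemma mxrow_bvec m q (B : 'I_q -> 'M[R]_(m, n)) f :
  (\mxrow_(j < q) B j) *m bvec q f = \sum_(j < q) B j *m f j.
Proof. by rewrite mul_mxrow_mxcol. Qed.

Lemma crow_bvec q (t : seq R) f :
  crow t *m bvec q f = \sum_(j < q) t`_j *: f j.
Proof.
by rewrite mxrow_bvec; apply: eq_bigr => j _; rewrite mul_scalar_mx.
Qed.

Lemma ssq_bvec p f : ssq (bvec p f) = \sum_(i < p) ssq (f i).
Proof.
rewrite ssq_qf /bf mulmx1 mul_tr_mxcol summxE; apply: eq_bigr => i _.
by rewrite ssq_qf /bf mulmx1.
Qed.

Lemma qf_bdiag p (s : seq 'M[R]_n) f :
  qf (bdiag s) (bvec p f) = \sum_(i < p) qf s`_i (f i).
Proof.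
rewrite /bdiag /mxdiag bf_mxblock; apply: eq_bigr => i _.
rewrite (bigD1 i) //= big1 => [|j ji]; last first.
  by rewrite eq_sym (negPf ji) bf0A.
by rewrite eqxx addr0 conform_mx_id.
Qed.

Lemma getblock_bvec p (A : 'M[R]_(bsize p n)) f :
  qf A (bvec p f) = \sum_(i < p) \sum_(j < p) bf (getblock A i j) (f i) (f j).
Proof.
rewrite -{1}(submxblockK A) bf_mxblock.
apply: eq_bigr => i _; apply: eq_bigr => j _.
by rewrite /getblock !valK.
Qed.

Lemma getblock_oversize p (A : 'M[R]_(bsize p n)) i j :
  ~~ ((i < p) && (j < p))%N -> getblock A i j = 0.
Proof.
rewrite negb_and /getblock => /orP[] ij.
  by rewrite insubN.
by case: insubP => // *; rewrite insubN.
Qed.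

(** Indices are split at [p]: [getblock A] is 0 past its range, and the guard in [bdiag2] removes
    [B] before it. *)
Lemma qf_bdiag2 p q r (A : 'M[R]_(bsize p n)) (B : 'M[R]_(bsize q n)) f :
  r = (p + q)%N ->
  qf (bdiag2 A B) (bvec r f)
  = qf A (bvec p f) + qf B (bvec q (fun i => f (p + i)%N)).
Proof.
move=> ->; rewrite /bdiag2 bf_mxblock !getblock_bvec.
under eq_bigr => i _ do under eq_bigr => j _ do rewrite bfDA.
under eq_bigr => i _ do rewrite big_split; rewrite big_split /=; congr (_ + _).
  rewrite big_split_ord /= [X in _ + X]big1 ?addr0 => [|i _]; last first.
    apply: big1 => j _; rewrite getblock_oversize ?bf0A //.
    by rewrite ltnNge leq_addr.
  apply: eq_bigr => i _; rewrite big_split_ord /= [X in _ + X]big1 ?addr0 //.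
  move=> j _; rewrite getblock_oversize ?bf0A //.
  by rewrite [(p + j < p)%N]ltnNge leq_addr andbF.
rewrite big_split_ord /= big1 ?add0r => [|i _]; last first.
  by apply: big1 => j _; rewrite leqNgt ltn_ord bf0A.
apply: eq_bigr => i _; rewrite big_split_ord /= big1 ?add0r => [|j _]; last first.
  by rewrite [(p <= j)%N]leqNgt ltn_ord andbF bf0A.
by apply: eq_bigr => j _; rewrite !leq_addr !addKn.
Qed.

End BlockVectors.

(** * Block tridiagonal matrices and the double sums that they encode *)

Section BlockTridiagonal.
Variables (R : realType) (n : nat).
Implicit Types (f g : nat -> 'cV[R]_n) (Q Z : 'M[R]_n) (q : nat -> R).

Lemma qf_btridiag p (D E : seq 'M[R]_n) f :
  qf (btridiag D E) (bvec p.+1 f)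
  = \sum_(i < p.+1) qf D`_i (f i) + 2 * \sum_(i < p) bf E`_i (f i) (f i.+1).
Proof.
(* [G] holds the strictly upper blocks; by transposition the lower ones contribute the same sum,
   whence the factor 2. *)
pose G (i j : nat) := if j == i.+1 then bf E`_i (f i) (f j) else 0.
have sumG : \sum_(i < p.+1) \sum_(j < p.+1) G i j
          = \sum_(i < p) bf E`_i (f i) (f i.+1).
  under eq_bigr => i _ do rewrite big_ord_recl add0r.
  rewrite big_ord_recr /= [X in _ + X]big1 => [|j _]; last first.
    by rewrite /G /= /bump /= add1n eqSS ltn_eqF.
  rewrite addr0; apply: eq_bigr => i _.
  rewrite (bigD1 i) //= big1 => [|j ji]; rewrite /G /bump /= add1n eqSS.
    by rewrite eqxx addr0.
  by rewrite ifN.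
have -> : qf (btridiag D E) (bvec p.+1 f)
    = \sum_(i < p.+1) \sum_(j < p.+1)
        ((if i == j then bf D`_i (f i) (f i) else 0) + G i j + G j i).
  rewrite bf_mxblock; apply: eq_bigr => i _; apply: eq_bigr => j _.
  rewrite /G -val_eqE /=; have [ij|ij] := eqVneq (i : nat) j.
    by rewrite ij ltn_eqF // !addr0.
  have [ji|ji] := eqVneq (j : nat) i.+1.
    by rewrite ji ltn_eqF ?addr0 ?add0r //; lia.
  by have [{}ij|_] := eqVneq (i : nat) j.+1; rewrite ?bf_trmx ?bf0A !add0r.
have -> : forall F1 F2 F3 : 'I_p.+1 -> 'I_p.+1 -> R,
    \sum_i \sum_j (F1 i j + F2 i j + F3 i j)
    = \sum_i \sum_j F1 i j + \sum_i \sum_j F2 i j + \sum_i \sum_j F3 i j.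
  move=> F1 F2 F3; rewrite -!big_split /=; apply: eq_bigr => i _.
  by rewrite -!big_split.
rewrite [X in _ + X = _]exchange_big /= !sumG -addrA mulr_natl mulr2n.
congr (_ + _); apply: eq_bigr => i _.
rewrite (bigD1 i) //= eqxx big1 ?addr0 // => j ji.
by rewrite eq_sym (negPf ji).
Qed.

(** With [q s = qf Z (f s)] and [b s = bf Z (f s) (f s.+1)] each summand on the right is
    [qf Z (f s - f s.+1)], and the left-hand side counts how often each term occurs; up to a factor
    [D] these counts are the weights in [Hcal]. Raising [D] by one adds the inner sum at [t = D]. *)
Lemma sum_weights_telescope (a D : nat) q (b : nat -> R) :
  D%:R * q 0%N + D%:R * \sum_(i < a) (2 * q i.+1 - 2 * b i)
  + \sum_(l < D) ((2 * D%:R - 2 * l.+1%:R + 1) * q (a + l).+1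
                  - 2 * (D%:R - l.+1%:R + 1) * b (a + l)%N)
  = \sum_(t < D) \sum_(s < (a + t).+1) (q s + q s.+1 - 2 * b s).
Proof.
have inner N : \sum_(s < N.+1) (q s + q s.+1 - 2 * b s)
    = q 0%N + q N.+1 - 2 * b N + \sum_(i < N) (2 * q i.+1 - 2 * b i).
  elim: N => [|N IHN]; first by rewrite big_ord1 big_ord0 addr0.
  by rewrite big_ord_recr IHN [in RHS]big_ord_recr /=; ring.
elim: D => [|D IHD]; first by rewrite !big_ord0 !mul0r !addr0.
rewrite [in RHS]big_ord_recr /= -IHD inner big_split_ord big_ord_recr /=.
rewrite -[D.+1]addn1 !natrD.
have -> : \sum_(l < D) ((2 * (D%:R + 1) - 2 * l.+1%:R + 1) * q (a + l).+1
                        - 2 * (D%:R + 1 - l.+1%:R + 1) * b (a + l)%N)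
  = \sum_(l < D) ((2 * D%:R - 2 * l.+1%:R + 1) * q (a + l).+1
                  - 2 * (D%:R - l.+1%:R + 1) * b (a + l)%N)
    + \sum_(l < D) (2 * q (a + l).+1 - 2 * b (a + l)%N).
  by rewrite -big_split /=; apply: eq_bigr => l _; ring.
ring.
Qed.

(** The double-sum term of a Lyapunov-Krasovskii functional, for the increments of a sequence that
    runs from the present into the past. *)
Definition delay_energy (a b : nat) Z f : R :=
  (b - a)%:R * \sum_(t < b - a) \sum_(s < (a + t).+1) qf Z (f s - f s.+1).

(** When time advances by one, each of the [b - a] inner sums gains the newest increment and loses
    its oldest one. *)
Lemma delay_energyB a b Z g :
  delay_energy a b Z g - delay_energy a b Z (fun i => g i.+1)
  = (b - a)%:R ^+ 2 * qf Z (g 0%N - g 1%N)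
    - (b - a)%:R * \sum_(l < b - a) qf Z (g (a + l).+1 - g (a + l).+2).
Proof.
rewrite /delay_energy -mulrBr -sumrB expr2 -mulrA -mulrBr; congr (_ * _).
rewrite -[X in X%:R * _]card_ord mulr_natl -sumr_const -sumrB.
apply: eq_bigr => t _.
by rewrite big_ord_recl /= big_ord_recr /=; rewrite /bump /=; ring.
Qed.

Lemma delay_energy_ge0 a b Z f : posdefmx Z -> 0 <= delay_energy a b Z f.
Proof.
move=> Zpos; rewrite mulr_ge0 //.
by do 2!apply: sumr_ge0 => ? _; exact: posdefmx_ge0.
Qed.

(** The weights match [sum_weights_telescope] twice: for [Z1] with lower delay 0, and for [Z2] with
    lower delay [a]. *)
Lemma qf_Hcal (a b : nat) Q1 Q2 Z1 Z2 f :
  (a <= b)%N -> Z1^T = Z1 -> Z2^T = Z2 ->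
  qf (Hcal a b Q1 Q2 Z1 Z2) (bvec b.+1 f)
  = \sum_(i < a) qf Q1 (f i.+1) + \sum_(l < b - a) qf Q2 (f (a + l).+1)
    + delay_energy 0 a Z1 f + delay_energy a b Z2 f.
Proof.
move=> ab Z1T Z2T; rewrite /Hcal qf_btridiag big_ord_recl /=.
set D := (b - a)%N; have bE : b = (a + D)%N by rewrite subnKC.
rewrite bE !big_split_ord /=.
have nthl (F G : nat -> 'M[R]_n) (i : 'I_a) :
    ([seq F i | i <- iota 1 a] ++ [seq G l | l <- iota 1 D])`_i = F i.+1.
  rewrite nth_cat size_map size_iota ltn_ord.
  by rewrite (nth_map 0%N) ?size_iota ?nth_iota.
have nthr (F G : nat -> 'M[R]_n) (l : 'I_D) :
    ([seq F i | i <- iota 1 a] ++ [seq G l | l <- iota 1 D])`_(a + l) = G l.+1.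
  rewrite nth_cat size_map size_iota ltnNge leq_addr addKn /=.
  by rewrite (nth_map 0%N) ?size_iota ?nth_iota.
under eq_bigr => i _ do rewrite nthl !(bfDA, bfZA).
under [X in _ + (_ + X) + _ = _]eq_bigr => i _ do rewrite nthr !(bfDA, bfZA).
under [X in _ + 2 * (X + _) = _]eq_bigr => i _ do
  rewrite nthl !(bfDA, bfNA, bfZA).
under [X in _ + 2 * (_ + X) = _]eq_bigr => i _ do
  rewrite nthr !(bfDA, bfNA, bfZA).
rewrite !(bfDA, bfZA).
have en c e Z : Z^T = Z -> delay_energy c (c + e) Z f
  = e%:R * (e%:R * qf Z (f 0%N)
      + e%:R * \sum_(i < c) (2 * qf Z (f i.+1) - 2 * bf Z (f i) (f i.+1))
      + \sum_(l < e) ((2 * e%:R - 2 * l.+1%:R + 1) * qf Z (f (c + l).+1)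
          - 2 * (e%:R - l.+1%:R + 1) * bf Z (f (c + l)%N) (f (c + l).+1))).
  move=> ZT; rewrite (sum_weights_telescope _ _ (fun i => qf Z (f i))
                        (fun i => bf Z (f i) (f i.+1))).
  rewrite /delay_energy addKn; congr (_ * _).
  apply: eq_bigr => t _; apply: eq_bigr => s _.
  by rewrite qfB //; ring.
rewrite en // -[a in delay_energy 0 a]add0n en //.
rewrite big_ord0 mulr0 addr0.
set SX := \sum_(i < a) _; set SY := \sum_(l < D) _.
set SV := \sum_(i < a) _; set SW := \sum_(l < D) _.
set TQ1 := \sum_(i < a) _; set TQ2 := \sum_(l < D) _.
set TA1 := \sum_(i < a) _; set TA2 := \sum_(i < a) _; set TD := \sum_(l < D) _.
have -> : SX = TQ1 + a%:R * TA1 + D%:R * (D%:R * TA2) - 2 * SV.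
  rewrite !mulr_sumr -!big_split -sumrB; apply: eq_bigr => i _ /=.
  by rewrite add0n; ring.
have -> : SY = TQ2 + D%:R * TD - 2 * SW.
  rewrite !mulr_sumr -!big_split -sumrB; apply: eq_bigr => i _ /=; ring.
ring.
Qed.

Lemma Hcal_aE (dn dM : nat) Z : Hcal_a dn dM Z = Hcal dn dM 0 0 0 Z.
Proof.
have nseqE (F : nat -> 'M[R]_n) c :
    (forall i, F i = c) -> [seq F i | i <- iota 1 dn] = nseq dn c.
  by move=> Fc; rewrite (eq_map Fc); elim: dn 1%N => //= k IHk i; rewrite IHk.
rewrite /Hcal_a /Hcal; congr btridiag; first congr (_ :: _ ++ _).
- by rewrite scaler0 add0r.
- rewrite (nseqE _ ((2 * (dM - dn)%:R ^+ 2) *: Z)) // => i.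
  by rewrite scaler0 addr0 add0r.
- by apply: eq_map => l; rewrite add0r.
- congr (_ ++ _).
  rewrite (nseqE _ (- ((dM - dn)%:R ^+ 2 *: Z))) // => i.
  by rewrite scaler0 subr0.
Qed.

End BlockTridiagonal.

(** * Discrete Wirtinger inequality *)

Section SummationInequality.
Variables (R : realType) (n : nat).
Implicit Types (f : nat -> 'cV[R]_n) (Z : 'M[R]_n).

Lemma sum_arith (K : R) (M : nat) :
  \sum_(i < M) (K - 2 * i%:R) = M%:R * K - M%:R * (M%:R - 1).
Proof.
elim: M => [|M IHM]; first by rewrite big_ord0; ring.
by rewrite big_ord_recr /= IHM -addn1 natrD; ring.
Qed.

Lemma sum_arith_sqr (K : R) (M : nat) :
  3 * \sum_(i < M) (K - 2 * i%:R) ^+ 2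
  = 3 * M%:R * K ^+ 2 - 6 * K * M%:R * (M%:R - 1)
    + 2 * M%:R * (M%:R - 1) * (2 * M%:R - 1).
Proof.
elim: M => [|M IHM]; first by rewrite big_ord0; ring.
by rewrite big_ord_recr /= mulrDr IHM -addn1 natrD; ring.
Qed.

Lemma sum_diff f (M : nat) : \sum_(i < M) (f i - f i.+1) = f 0%N - f M.
Proof.
elim: M => [|M IHM]; first by rewrite big_ord0 subrr.
by rewrite big_ord_recr /= IHM addrA subrK.
Qed.

(** Summation by parts. For [M = N] and [K = N - 1] the right-hand side becomes [N + 1] times
    [endpoint_defect]. *)
Lemma sum_arith_diff (K : R) f (M : nat) :
  \sum_(i < M) (K - 2 * i%:R) *: (f i - f i.+1)
  = (K + 2) *: f 0%N - (K - 2 * M%:R) *: f M - 2 *: \sum_(i < M.+1) f i.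
Proof.
elim: M => [|M IHM].
  by rewrite big_ord0 big_ord1; apply/matrixP => i j; rewrite !mxE; ring.
rewrite big_ord_recr /= IHM [in RHS]big_ord_recr /=.
move: (\sum_(i < M.+1) f i) => s.
by apply/matrixP => i j; rewrite !mxE -addn1 natrD; ring.
Qed.

Definition mean f (N : nat) : 'cV[R]_n := N.+1%:R^-1 *: \sum_(i < N.+1) f i.

Lemma meanE f (N : nat) : (N%:R + 1) *: mean f N = \sum_(i < N.+1) f i.
Proof.
by rewrite /mean scalerA natr1 divff ?scale1r // pnatr_eq0.
Qed.

(** Twice the gap between the average of the two end values and the mean over the whole interval. *)
Definition endpoint_defect f (N : nat) : 'cV[R]_n :=
  f 0%N + f N - 2 *: mean f N.

(* Bessel's inequality: the differences [f i - f i.+1] are projected on the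
   constants and on the centred arithmetic progression [N - 1 - 2 i]. *)
Lemma wirtinger_sum Z f (N : nat) : posdefmx Z -> (0 < N)%N ->
  qf Z (f 0%N - f N) + 3 * gammaw R N * qf Z (endpoint_defect f N)
  <= N%:R * \sum_(i < N) qf Z (f i - f i.+1).
Proof.
move=> Zpos N0; have ZT := Zpos.1; rewrite /gammaw.
have wE : (N%:R + 1) *: endpoint_defect f N
          = \sum_(i < N) (N%:R - 1 - 2 * i%:R) *: (f i - f i.+1).
  rewrite sum_arith_diff -meanE /endpoint_defect.
  by apply/matrixP => i j; rewrite !mxE; ring.
(* For [N = 1] the centred progression is the single value 0, so only the projection on the
   constants remains. *)
case: eqVneq => [N1|N1].
  have -> : endpoint_defect f N = 0.
    apply/eqP; have/eqP : (N%:R + 1) *: endpoint_defect f N = 0.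
      by rewrite wE N1 big_ord1 /=; apply/matrixP => i j; rewrite !mxE; ring.
    by rewrite scaler_eq0 natr1 pnatr_eq0.
  by rewrite bf0l mulr0 addr0 N1 big_ord1 mul1r.
have N2 : 1 < N%:R :> R by rewrite ltr1n; lia.
set w := endpoint_defect f N in wE *.
set O := f 0%N - f N.
set S := \sum_(i < N) qf Z (f i - f i.+1).
(* Projection coefficients: the constant sequence 1 has squared norm [N], the progression has
   [N * (N ^+ 2 - 1) / 3]; the inner product of the latter with the differences is [(N + 1) *: w],
   which leaves [3 / (N * (N - 1))]. *)
pose a : R := N%:R^-1; pose b : R := 3 / (N%:R * (N%:R - 1)).
pose c (i : nat) : R := N%:R - 1 - 2 * i%:R.
have : 0 <= \sum_(i < N) qf Z (f i - f i.+1 - (a *: O + (b * c i) *: w)).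
  by apply: sumr_ge0 => i _; exact: posdefmx_ge0.
have -> : \sum_(i < N) qf Z (f i - f i.+1 - (a *: O + (b * c i) *: w))
  = S - 2 * (a * \sum_(i < N) bf Z (f i - f i.+1) O
             + b * \sum_(i < N) bf Z (c i *: (f i - f i.+1)) w)
    + (a ^+ 2 * qf Z O) * \sum_(i < N) 1
    + 2 * a * b * bf Z O w * \sum_(i < N) c i
    + b ^+ 2 * qf Z w * \sum_(i < N) c i ^+ 2.
  rewrite !mulr_sumr -big_split /= !mulr_sumr /S -sumrB -!big_split /=.
  apply: eq_bigr => i _.
  move: (f i - f i.+1) (c i) => x ci; clearbody O w.
  by rewrite qfB // qfD // !(bfDr, bfZl, bfZr); ring.
rewrite -!bf_suml sum_diff -wE bfZl -/O sumr_const card_ord sum_arith.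
have -> : \sum_(i < N) c i ^+ 2 = N%:R * (N%:R ^+ 2 - 1) / 3.
  have := sum_arith_sqr (N%:R - 1) N; rewrite -/(c _) => h.
  apply: (@mulfI _ 3) => //.
  by rewrite h; field.
move: (qf Z O) (qf Z w) (bf Z O w) S => qO qw bO S h.
have := mulr_ge0 (ler0n R N) h.
move=> h'; rewrite -subr_ge0; apply: le_trans h' _.
rewrite le_eqVlt; apply/orP; left; apply/eqP; rewrite /a /b; field.
by rewrite subr_eq0 !gt_eqF //; lra.
Qed.

Lemma gammaw_ge1 (N : nat) : (0 < N)%N -> 1 <= gammaw R N.
Proof.
move=> N0; rewrite /gammaw; case: eqVneq => // N1.
have N2 : 1 < N%:R :> R by rewrite ltr1n; lia.
by rewrite ler_pdivlMr; lra.
Qed.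

Lemma endpoint_defect0 f : endpoint_defect f 0 = 0.
Proof.
rewrite /endpoint_defect /mean big_ord1.
by apply/matrixP => i j; rewrite !mxE; field.
Qed.

(** The constant is lowered to the uniform value 3 used in [Zcal], and [N = 0] is covered: one part
    of a delay interval is empty when the delay sits at an end. *)
Lemma wirtinger_sum_weak Z f (N : nat) : posdefmx Z ->
  qf Z (f 0%N - f N) + 3 * qf Z (endpoint_defect f N)
  <= N%:R * \sum_(i < N) qf Z (f i - f i.+1).
Proof.
move=> Zpos; case: N => [|N].
  by rewrite endpoint_defect0 subrr !bf0l mul0r; lra.
apply: le_trans (wirtinger_sum f Zpos (ltn0Sn N)).
rewrite lerD2l -mulrA ler_pM2l // -{1}[qf _ _]mul1r.
by rewrite ler_wpM2r ?gammaw_ge1 // posdefmx_ge0.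
Qed.

End SummationInequality.

(** * Reciprocal convexity *)

Section ReciprocalConvexity.
Variables (R : realType) (k : nat) (T X : 'M[R]_k).

Lemma qf_block_mx u v :
  qf (block_mx T X X^T T) (col_mx u v) = qf T u + 2 * bf X u v + qf T v.
Proof.
have addE (A B : 'M[R]_1) : (A + B) 0 0 = A 0 0 + B 0 0 by rewrite mxE.
have XT := bf_trmx X u v; rewrite /bf in XT *.
rewrite tr_col_mx mul_row_block mul_row_col !mulmxDl !addE XT; ring.
Qed.

(** The usual inequality with denominators cleared: [n1] and [n2] are the lengths of the two parts
    of an interval, and a part of length 0 is allowed because its vector then vanishes. *)
Lemma reciprocally_convex (n1 n2 s1 s2 : R) u v :
  posdefmx (block_mx T X X^T T) ->
  0 <= n1 -> 0 <= n2 -> 0 <= s1 -> 0 <= s2 ->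
  (n1 = 0 -> v = 0) -> (n2 = 0 -> u = 0) ->
  qf T v <= n1 * s1 -> qf T u <= n2 * s2 ->
  qf (block_mx T X X^T T) (col_mx u v) <= (n1 + n2) * (s1 + s2).
Proof.
move=> Ppos n1_ge0 n2_ge0 s1_ge0 s2_ge0 v0 u0 hv hu; rewrite qf_block_mx.
have [n10|n1_neq0] := eqVneq n1 0.
  rewrite (v0 n10) bf0l bf0r n10; nra.
have [n20|n2_neq0] := eqVneq n2 0.
  rewrite (u0 n20) !bf0l n20; nra.
have n1_gt0 : 0 < n1 by rewrite lt_def n1_neq0.
have n2_gt0 : 0 < n2 by rewrite lt_def n2_neq0.
(* The weights [n1] and [- n2] give the cross term [- 2 * n1 * n2 * bf X u v]; adding [hv] and [hu]
   with the multipliers below yields exactly [n1 * n2] times the required gap. *)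
have := posdefmx_ge0 (col_mx (n1 *: u) (- (n2 *: v))) Ppos.
rewrite qf_block_mx qfN bfNr !(bfZl, bfZr).
move: (qf T u) (qf T v) (bf X u v) hu hv => qu qv b hu hv h.
rewrite -subr_ge0 -(pmulr_rge0 _ (mulr_gt0 n1_gt0 n2_gt0)).
have h1 : 0 <= (n1 * n2 + n2 ^+ 2) * (n1 * s1 - qv).
  by rewrite mulr_ge0 ?subr_ge0 // addr_ge0 ?mulr_ge0 ?sqr_ge0.
have h2 : 0 <= (n1 * n2 + n1 ^+ 2) * (n2 * s2 - qu).
  by rewrite mulr_ge0 ?subr_ge0 // addr_ge0 ?mulr_ge0 ?sqr_ge0.
apply: le_trans (addr_ge0 (addr_ge0 h1 h2) h) _.
by rewrite le_eqVlt; apply/orP; left; apply/eqP; ring.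
Qed.

End ReciprocalConvexity.

(** * The functionals represented by [Sbar_1] and [Sbar_2] *)

Section LyapunovFunctionals.
Variables (R : realType) (n : nat).
Implicit Types (f g : nat -> 'cV[R]_n).

Definition skip (a : nat) f : nat -> 'cV[R]_n := fun i => f (a + i)%N.

Definition window (a b : nat) f : 'cV[R]_n := \sum_(l < b - a) f (a + l).+1.

Lemma windowE (a b N : nat) f : (a <= b)%N -> (b <= N)%N ->
  \sum_(c < N.+1) ((a.+1 <= c <= b)%N)%:R *: f c = window a b f.
Proof.
move=> ab bN; rewrite /window.
have -> : N.+1 = (a.+1 + ((b - a) + (N - b)))%N by lia.
rewrite !big_split_ord /= big1 ?add0r => [|i _]; last first.
  by rewrite (_ : (_ && _) = false) ?scale0r //; have := ltn_ord i; lia.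
rewrite [X in _ + X]big1 ?addr0 => [|i _]; last first.
  by rewrite (_ : (_ && _) = false) ?scale0r //; have := ltn_ord i; lia.
apply: eq_bigr => i _; rewrite addSn (_ : (_ && _) = true) ?scale1r //.
by have := ltn_ord i; lia.
Qed.

Lemma window0E N f : \sum_(c < N.+1) (c == 0 :> nat)%:R *: f c = f 0%N.
Proof.
rewrite big_ord_recl /= scale1r big1 ?addr0 // => i _.
by rewrite scale0r.
Qed.

(** The augmented state weighted by [P2]; sequences list states from the most recent to the
    oldest. *)
Definition summary2 (dn dM : nat) f : seq 'cV[R]_n :=
  [:: f 0%N; window 0 dn f; window dn dM f].

Definition summary1 (dm dn dM : nat) f : seq 'cV[R]_n :=
  [:: f 0%N; window 0 dm f; window dm dn f; window dn dM f].

Lemma mxblock_scalar_bvec p q (B : nat -> nat -> R) f :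
  (\mxblock_(i < p, c < q) ((B i c)%:M : 'M[R]_n)) *m bvec q f
  = bvec p (fun i => \sum_(c < q) B i c *: f c).
Proof.
rewrite mxblock_bvec; apply: eq_mxcol => i; apply: eq_bigr => c _.
by rewrite mul_scalar_mx.
Qed.

Lemma W5_2_bvec (dn dM : nat) f : (dn <= dM)%N ->
  W5_2 R n dn dM *m bvec dM.+1 f = bvec 3 (nth 0 (summary2 dn dM f)).
Proof.
move=> nM; rewrite /W5_2 (mxblock_scalar_bvec _ _ (fun i c =>
  (nth false [:: c == 0%N; (1 <= c <= dn)%N; (dn.+1 <= c <= dM)%N] i)%:R)).
apply: eq_bvec => -[|[|[|//]]] _ /=.
- exact: window0E.
- exact: windowE.
- exact: windowE.
Qed.

Lemma W5_1_bvec (dm dn dM : nat) f : (dm <= dn)%N -> (dn <= dM)%N ->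
  W5_1 R n dm dn dM *m bvec dM.+1 f = bvec 4 (nth 0 (summary1 dm dn dM f)).
Proof.
move=> mn nM; rewrite /W5_1 (mxblock_scalar_bvec _ _ (fun i c =>
  (nth false [:: c == 0%N; (1 <= c <= dm)%N; (dm.+1 <= c <= dn)%N;
                 (dn.+1 <= c <= dM)%N] i)%:R)).
apply: eq_bvec => -[|[|[|[|//]]]] _ /=.
- exact: window0E.
- by apply: windowE => //; exact: leq_trans nM.
- exact: windowE.
- exact: windowE.
Qed.

Definition state_energy (a b : nat) (Q : 'M[R]_n) f : R :=
  \sum_(l < b - a) qf Q (f (a + l).+1).

Lemma state_energyB (a b : nat) Q g : (a <= b)%N ->
  state_energy a b Q g - state_energy a b Q (fun i => g i.+1)
  = qf Q (g a.+1) - qf Q (g b.+1).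
Proof.
move=> ab; rewrite /state_energy.
have -> : qf Q (g b.+1) = qf Q (g (a + (b - a)).+1) by rewrite subnKC.
move: (b - a)%N => N.
rewrite -sumrB; elim: N => [|N IHN]; first by rewrite big_ord0 addn0 subrr.
by rewrite big_ord_recr /= IHN addnS; ring.
Qed.

Lemma state_energy_ge0 (a b : nat) Q f :
  posdefmx Q -> 0 <= state_energy a b Q f.
Proof. by move=> Qpos; apply: sumr_ge0 => l _; exact: posdefmx_ge0. Qed.

Lemma qf_Sbar_2 (dn dM : nat) P2 (Q12 Q22 Z12 Z22 : 'M[R]_n) f :
  (dn <= dM)%N -> Z12^T = Z12 -> Z22^T = Z22 ->
  qf (Sbar_2 dn dM P2 Q12 Q22 Z12 Z22) (bvec dM.+1 f)
  = qf P2 (bvec 3 (nth 0 (summary2 dn dM f)))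
    + state_energy 0 dn Q12 f + state_energy dn dM Q22 f
    + delay_energy 0 dn Z12 f + delay_energy dn dM Z22 f.
Proof.
move=> nM Z1T Z2T; rewrite /Sbar_2 bfDA bf_mulmx W5_2_bvec // qf_Hcal //.
by rewrite !addrA /state_energy subn0.
Qed.

Lemma qf_Sbar_1 (dm dn dM : nat) P1 (Q11 Q21 Q31 Z11 Z21 Z31 : 'M[R]_n) f :
  (dm <= dn)%N -> (dn <= dM)%N -> Z11^T = Z11 -> Z21^T = Z21 -> Z31^T = Z31 ->
  qf (Sbar_1 dm dn dM P1 Q11 Q21 Q31 Z11 Z21 Z31) (bvec dM.+1 f)
  = qf P1 (bvec 4 (nth 0 (summary1 dm dn dM f)))
    + state_energy 0 dm Q11 f + state_energy dm dn Q21 f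
    + state_energy dn dM Q31 f
    + delay_energy 0 dm Z11 f + delay_energy dm dn Z21 f
    + delay_energy dn dM Z31 f.
Proof.
move=> mn nM Z1T Z2T Z3T; rewrite /Sbar_1 /Pcal_1 !bfDA bf_mulmx W5_1_bvec //.
(* [Hcal_aE] turns the last matrix into a second [Hcal], of which only the [Z31] double sum
   survives. *)
rewrite qf_bdiag2 ?addSn ?subnKC // Hcal_aE !qf_Hcal ?trmx0 // qf_bdiag.
rewrite [\sum_(i < dn) qf 0 _]big1 => [|i _]; last by rewrite bf0A.
rewrite [\sum_(l < _) qf 0 _]big1 => [|i _]; last by rewrite bf0A.
have -> : delay_energy 0 dn 0 f = 0.
  rewrite /delay_energy big1 ?mulr0 // => t _.
  by rewrite big1 // => s _; rewrite bf0A.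
have -> : \sum_(i < dM - dn) qf (nseq (dM - dn) Q31)`_i (f (dn.+1 + i)%N)
          = state_energy dn dM Q31 f.
  by apply: eq_bigr => i _; rewrite nth_nseq ltn_ord.
by rewrite /state_energy subn0; ring.
Qed.

End LyapunovFunctionals.

(** * Increments of the functionals expressed through the end point matrices *)

Section EndpointConditions.
Variables (R : realType) (n : nat).
Implicit Types (f g : nat -> 'cV[R]_n) (Z Q : 'M[R]_n).

(** If [g] starts at time [k + 1], this is the history seen at time [k]. *)
Definition past g : nat -> 'cV[R]_n := fun i => g i.+1.

(** The mean runs over [N + 1] states, the window over [N]. At time [k + 1] the window omits the
    oldest of them, at time [k] (next lemma) the newest; this is the source of the entries [-1] in
    [W2tab] and [W1tab]. *)
Lemma mean_window a N g :
  window a (a + N) g = (N%:R + 1) *: mean (skip a.+1 g) N - g (a + N).+1.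
Proof. by rewrite /window addKn meanE big_ord_recr /= addrK. Qed.

Lemma mean_window_past a N g :
  window a (a + N) (past g) = (N%:R + 1) *: mean (skip a.+1 g) N - g a.+1.
Proof.
rewrite /window addKn meanE big_ord_recl /= /skip addn0 addrAC subrr add0r.
by apply: eq_bigr => i _; rewrite /past /bump /= addnS.
Qed.

Lemma window_cat a n1 n2 f :
  window a (a + n1 + n2) f
  = window a (a + n1) f + window (a + n1) (a + n1 + n2) f.
Proof.
rewrite /window -addnA !addKn addnA addKn big_split_ord; congr (_ + _).
by apply: eq_bigr => i _; rewrite /= addnA.
Qed.

(* The vector on which the end point conditions are evaluated when the delay is
   [a + n1] and the delay interval is [[a, a + n1 + n2]]; [g] lists
   [x(k + 1), x(k), x(k - 1)] and so on. *)
Definition zeta (a n1 n2 : nat) g : seq 'cV[R]_n :=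
  [:: g 0%N; g 1%N; g a.+1; g (a + n1).+1; g (a + n1 + n2).+1;
      mean (skip 1 g) a; mean (skip a.+1 g) n1; mean (skip (a + n1).+1 g) n2].

Definition zeta1 (a n1 n2 n3 : nat) g : seq 'cV[R]_n :=
  zeta a n1 n2 g
  ++ [:: g (a + n1 + n2 + n3).+1; mean (skip (a + n1 + n2).+1 g) n3].

(** At delay [a + n1], [Wd_2] turns the weights [1 - a] and [b + 1] of the last two means, [b] being
    the upper end, into [n1 + 1] and [n2 + 1], so that each mean becomes a sum. *)
Lemma W2_2_zeta (a n1 n2 : nat) g :
  (W2_2 R n a (a + n1 + n2) + Wd_2 R n (a + n1))
    *m bvec 8 (nth 0 (zeta a n1 n2 g))
  = bvec 3 (nth 0 (summary2 a (a + n1 + n2) g)).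
Proof.
rewrite mulmxDl !cblock_bvec bvecD; apply: eq_bvec.
have w0 := mean_window 0 a g; rewrite add0n in w0.
have w1 := mean_window a n1 g; have w2 := mean_window (a + n1) n2 g.
move=> [|[|[|//]]] _; rewrite !big_ord_recr !big_ord0 /=;
  rewrite ?window_cat ?w0 ?w1 ?w2;
  move: (mean _ _) (mean _ _) (mean _ _) => m0 m1 m2;
  apply/matrixP => i j; rewrite !mxE ?natrD; ring.
Qed.

Lemma W1_2_zeta (a n1 n2 : nat) g :
  (W1_2 R n a (a + n1 + n2) + Wd_2 R n (a + n1))
    *m bvec 8 (nth 0 (zeta a n1 n2 g))
  = bvec 3 (nth 0 (summary2 a (a + n1 + n2) (past g))).
Proof.
rewrite mulmxDl !cblock_bvec bvecD; apply: eq_bvec.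
have w0 := mean_window_past 0 a g; rewrite add0n in w0.
have w1 := mean_window_past a n1 g; have w2 := mean_window_past (a + n1) n2 g.
move=> [|[|[|//]]] _; rewrite !big_ord_recr !big_ord0 /=;
  rewrite ?window_cat ?w0 ?w1 ?w2 /past;
  move: (mean _ _) (mean _ _) (mean _ _) => m0 m1 m2;
  apply/matrixP => i j; rewrite !mxE ?natrD; ring.
Qed.

Lemma W2_1_zeta (a n1 n2 n3 : nat) g :
  (W2_1 R n a (a + n1 + n2) (a + n1 + n2 + n3) + Wd_1 R n (a + n1))
    *m bvec 10 (nth 0 (zeta1 a n1 n2 n3 g))
  = bvec 4 (nth 0 (summary1 a (a + n1 + n2) (a + n1 + n2 + n3) g)).
Proof.
rewrite mulmxDl !cblock_bvec bvecD addKn; apply: eq_bvec.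
have w0 := mean_window 0 a g; rewrite add0n in w0.
have w1 := mean_window a n1 g; have w2 := mean_window (a + n1) n2 g.
have w3 := mean_window (a + n1 + n2) n3 g.
move=> [|[|[|[|//]]]] _; rewrite !big_ord_recr !big_ord0 /=;
  rewrite ?w3 ?window_cat ?w0 ?w1 ?w2;
  move: (mean _ _) (mean _ _) (mean _ _) (mean _ _) => m0 m1 m2 m3;
  apply/matrixP => i j; rewrite !mxE ?natrD; ring.
Qed.

Lemma W1_1_zeta (a n1 n2 n3 : nat) g :
  (W1_1 R n a (a + n1 + n2) (a + n1 + n2 + n3) + Wd_1 R n (a + n1))
    *m bvec 10 (nth 0 (zeta1 a n1 n2 n3 g))
  = bvec 4 (nth 0 (summary1 a (a + n1 + n2) (a + n1 + n2 + n3) (past g))).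
Proof.
rewrite mulmxDl !cblock_bvec bvecD addKn; apply: eq_bvec.
have w0 := mean_window_past 0 a g; rewrite add0n in w0.
have w1 := mean_window_past a n1 g; have w2 := mean_window_past (a + n1) n2 g.
have w3 := mean_window_past (a + n1 + n2) n3 g.
move=> [|[|[|[|//]]]] _; rewrite !big_ord_recr !big_ord0 /=;
  rewrite ?w3 ?window_cat ?w0 ?w1 ?w2 /past;
  move: (mean _ _) (mean _ _) (mean _ _) (mean _ _) => m0 m1 m2 m3;
  apply/matrixP => i j; rewrite !mxE ?natrD; ring.
Qed.

Definition endpoints f (N : nat) : seq 'cV[R]_n :=
  [:: f 0%N - f N; endpoint_defect f N].

Lemma Ws_2_zeta (a n1 n2 : nat) g :
  Ws_2 R n *m bvec 8 (nth 0 (zeta a n1 n2 g))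
  = bvec 2 (nth 0 (endpoints (skip 1 g) a)).
Proof.
rewrite cblock_bvec; apply: eq_bvec => -[|[|//]] _;
  rewrite !big_ord_recr !big_ord0 /= /endpoint_defect;
  move: (mean _ _) (mean _ _) (mean _ _) => m0 m1 m2;
  apply/matrixP => i j; rewrite /skip !addn0 !mxE; ring.
Qed.

Lemma Ws_1_zeta (a n1 n2 n3 : nat) g :
  Ws_1 R n *m bvec 10 (nth 0 (zeta1 a n1 n2 n3 g))
  = bvec 2 (nth 0 (endpoints (skip 1 g) a)).
Proof.
rewrite cblock_bvec; apply: eq_bvec => -[|[|//]] _;
  rewrite !big_ord_recr !big_ord0 /= /endpoint_defect;
  move: (mean _ _) (mean _ _) (mean _ _) (mean _ _) => m0 m1 m2 m3;
  apply/matrixP => i j; rewrite /skip !addn0 !mxE; ring.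
Qed.

Lemma WPsi_2_zeta (a n1 n2 : nat) g :
  WPsi_2 R n *m bvec 8 (nth 0 (zeta a n1 n2 g))
  = col_mx (bvec 2 (nth 0 (endpoints (skip (a + n1).+1 g) n2)))
           (bvec 2 (nth 0 (endpoints (skip a.+1 g) n1))).
Proof.
rewrite mul_col_mx !cblock_bvec; congr col_mx; apply: eq_bvec => -[|[|//]] _;
  rewrite !big_ord_recr !big_ord0 /= /endpoint_defect;
  move: (mean _ _) (mean _ _) (mean _ _) => m0 m1 m2;
  apply/matrixP => i j; rewrite /skip !addn0 !addSn !mxE; ring.
Qed.

Lemma WPsi_1_zeta (a n1 n2 n3 : nat) g :
  WPsi_1 R n *m bvec 10 (nth 0 (zeta1 a n1 n2 n3 g))
  = col_mx (bvec 2 (nth 0 (endpoints (skip (a + n1).+1 g) n2)))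
           (bvec 2 (nth 0 (endpoints (skip a.+1 g) n1))).
Proof.
rewrite mul_col_mx !cblock_bvec; congr col_mx; apply: eq_bvec => -[|[|//]] _;
  rewrite !big_ord_recr !big_ord0 /= /endpoint_defect;
  move: (mean _ _) (mean _ _) (mean _ _) (mean _ _) => m0 m1 m2 m3;
  apply/matrixP => i j; rewrite /skip !addn0 !addSn !mxE; ring.
Qed.

Lemma Wz_zeta (a n1 n2 n3 : nat) g :
  Wz R n *m bvec 10 (nth 0 (zeta1 a n1 n2 n3 g))
  = bvec 2 (nth 0 (endpoints (skip (a + n1 + n2).+1 g) n3)).
Proof.
rewrite cblock_bvec; apply: eq_bvec => -[|[|//]] _;
  rewrite !big_ord_recr !big_ord0 /= /endpoint_defect;
  move: (mean _ _) (mean _ _) (mean _ _) (mean _ _) => m0 m1 m2 m3;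
  apply/matrixP => i j; rewrite /skip !addn0 !addSn !mxE; ring.
Qed.

Lemma W3_2_zeta (a n1 n2 : nat) g :
  W3_2 R n *m bvec 8 (nth 0 (zeta a n1 n2 g)) = g 0%N - g 1%N.
Proof.
rewrite crow_bvec !big_ord_recr !big_ord0 /=.
move: (mean _ _) (mean _ _) (mean _ _) => m0 m1 m2.
by apply/matrixP => i j; rewrite !mxE; ring.
Qed.

Lemma W3_1_zeta (a n1 n2 n3 : nat) g :
  W3_1 R n *m bvec 10 (nth 0 (zeta1 a n1 n2 n3 g)) = g 0%N - g 1%N.
Proof.
rewrite crow_bvec !big_ord_recr !big_ord0 /=.
move: (mean _ _) (mean _ _) (mean _ _) (mean _ _) => m0 m1 m2 m3.
by apply/matrixP => i j; rewrite !mxE; ring.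
Qed.

Lemma qf_Zcal Z f N :
  qf (Zcal Z) (bvec 2 (nth 0 (endpoints f N)))
  = qf Z (f 0%N - f N) + 3 * qf Z (endpoint_defect f N).
Proof.
by rewrite qf_bdiag !big_ord_recr big_ord0 /= add0r bfZA.
Qed.

Lemma qf_Zcal1 Z f a N :
  qf (Zcal1 a Z) (bvec 2 (nth 0 (endpoints f N)))
  = qf Z (f 0%N - f N) + 3 * gammaw R a * qf Z (endpoint_defect f N).
Proof.
by rewrite qf_bdiag !big_ord_recr big_ord0 /= add0r bfZA.
Qed.

Lemma delay_energy_past (a b : nat) Z g :
  delay_energy a b Z g - delay_energy a b Z (past g)
  = (b - a)%:R ^+ 2 * qf Z (g 0%N - g 1%N)
    - (b - a)%:R * \sum_(i < b - a)
        qf Z (skip a.+1 g i - skip a.+1 g i.+1).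
Proof.
rewrite delay_energyB; congr (_ - _ * _); apply: eq_bigr => l _.
by rewrite /skip addnS.
Qed.

Lemma delay_energy_Zcal1 a Z g : posdefmx Z -> (0 < a)%N ->
  delay_energy 0 a Z g - delay_energy 0 a Z (past g)
  <= a%:R ^+ 2 * qf Z (g 0%N - g 1%N)
     - qf (Zcal1 a Z) (bvec 2 (nth 0 (endpoints (skip 1 g) a))).
Proof.
move=> Zpos a0; rewrite delay_energy_past subn0 lerD2l lerN2 qf_Zcal1.
exact: wirtinger_sum.
Qed.

Lemma delay_energy_Zcal a N Z g : posdefmx Z ->
  delay_energy a (a + N) Z g - delay_energy a (a + N) Z (past g)
  <= N%:R ^+ 2 * qf Z (g 0%N - g 1%N)
     - qf (Zcal Z) (bvec 2 (nth 0 (endpoints (skip a.+1 g) N))).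
Proof.
move=> Zpos; rewrite delay_energy_past addKn lerD2l lerN2 qf_Zcal.
exact: wirtinger_sum_weak.
Qed.

Lemma endpoints0 f : bvec 2 (nth 0 (endpoints f 0)) = 0.
Proof.
rewrite -(scale0r (bvec 2 (nth 0 (endpoints f 0)))) bvecZ.
by apply: eq_bvec => -[|[|//]] _ /=; rewrite ?subrr ?endpoint_defect0 scale0r.
Qed.

(** The sum of increments is cut at the delay [a + n1]; each part obeys the weak Wirtinger
    inequality with its own length, and reciprocal convexity merges both bounds under the common
    factor [n1 + n2]. *)
Lemma delay_energy_Psiz a n1 n2 Z X g :
  posdefmx Z -> posdefmx (Psiz Z X) ->
  delay_energy a (a + n1 + n2) Z g - delay_energy a (a + n1 + n2) Z (past g)
  <= (n1 + n2)%:R ^+ 2 * qf Z (g 0%N - g 1%N)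
     - qf (Psiz Z X)
          (col_mx (bvec 2 (nth 0 (endpoints (skip (a + n1).+1 g) n2)))
                  (bvec 2 (nth 0 (endpoints (skip a.+1 g) n1)))).
Proof.
move=> Zpos Ppos; rewrite delay_energy_past -addnA addKn lerD2l lerN2.
rewrite big_split_ord natrD /=.
have -> : \sum_(i < n2) qf Z (skip a.+1 g (n1 + i)%N - skip a.+1 g (n1 + i).+1)
  = \sum_(i < n2) qf Z (skip (a + n1).+1 g i - skip (a + n1).+1 g i.+1).
  by apply: eq_bigr => i _; rewrite /skip !addSn !addnA !addnS !addnA.
apply: reciprocally_convex => //.
- by apply: sumr_ge0 => i _; exact: posdefmx_ge0.
- by apply: sumr_ge0 => i _; exact: posdefmx_ge0.
- by move=> /eqP; rewrite pnatr_eq0 => /eqP ->; exact: endpoints0.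
- by move=> /eqP; rewrite pnatr_eq0 => /eqP ->; exact: endpoints0.
- by rewrite qf_Zcal; exact: wirtinger_sum_weak.
- by rewrite qf_Zcal; exact: wirtinger_sum_weak.
Qed.

End EndpointConditions.

(** * One-step descent of the two functionals *)

Section Descent.
Variables (R : realType) (n : nat).
Implicit Types (g z : nat -> 'cV[R]_n).

(** The matrix is the symmetrised product of the multiplier [[I, eps I, 0, 0, 0]] with the row of
    the dynamics, hence its form vanishes along solutions. *)
Lemma qf_Ups_a (eps : R) (J A Am Ad AM : 'M[R]_n) z :
  qf (Ups_a eps J A Am Ad AM) (bvec 5 z)
  = 2 * bf 1%:M (z 0%N + eps *: z 1%N)
      (- J^T *m z 0%N + A *m z 1%N + Am *m z 2%N + Ad *m z 3%N + AM *m z 4%N).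
Proof.
have mulE (M : 'M[R]_n) u v : bf 1%:M u (M *m v) = bf M u v.
  by rewrite -bf_mulmxr mul1mx.
rewrite bf_mxblock !big_ord_recr !big_ord0 /=.
rewrite !(bf_trmx, bfDA, bfNA, bfZA, bf0A).
by rewrite !(bfDl, bfDr, bfZl, bfZr, mulE) !(bf_trmx, bfNA); ring.
Qed.

Lemma qf_Ups_2 (eps : R) (J A An Ad : 'M[R]_n) z :
  - J^T *m z 0%N + A *m z 1%N + An *m z 2%N + Ad *m z 3%N = 0 ->
  qf (Ups_2 eps J A An Ad) (bvec 8 z) = 0.
Proof.
move=> z0; rewrite /Ups_2 qf_bdiag2 // bf0A addr0 qf_Ups_a mul0mx addr0 z0.
by rewrite bf0r mulr0.
Qed.

Lemma qf_Ups_1 (eps : R) (J A An Ad : 'M[R]_n) z :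
  - J^T *m z 0%N + A *m z 1%N + An *m z 4%N + Ad *m z 3%N = 0 ->
  qf (Ups_1 eps J A An Ad) (bvec 10 z) = 0.
Proof.
move=> z0; rewrite /Ups_1 qf_bdiag2 // bf0A addr0 qf_Ups_a mul0mx addr0.
by rewrite addrAC z0 bf0r mulr0.
Qed.

(** Both augmented states contain the same delay-dependent term [Wd *m v], whose square cancels in
    the difference; the cross term that remains is linear in [Wd]. *)
Lemma qf_increment p q (P : 'M[R]_p) (W1 W2 Wd : 'M[R]_(p, q)) v : P^T = P ->
  qf (W2^T *m P *m W2 - W1^T *m P *m W1 + mxHe (Wd^T *m P *m (W2 - W1))) v
  = qf P ((W2 + Wd) *m v) - qf P ((W1 + Wd) *m v).
Proof.
move=> PT; rewrite bfDA qf_mxHe bfDA bfNA !bf_mulmx mulmxBl !mulmxDl.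
move: (W1 *m v) (W2 *m v) (Wd *m v) => w1 w2 wd.
by rewrite !qfD // bfDr bfNr (bfC wd w1) // (bfC wd w2) //; ring.
Qed.

Lemma qf_Qcal_2 (Q1 Q2 : 'M[R]_n) z :
  qf (Qcal_2 Q1 Q2) (bvec 8 z)
  = qf Q1 (z 1%N) + (qf Q2 (z 2%N) - qf Q1 (z 2%N)) - qf Q2 (z 4%N).
Proof.
rewrite qf_bdiag !big_ord_recr big_ord0 /=.
by rewrite !(bfDA, bfNA, bf0A); ring.
Qed.

Lemma qf_Qcal_1 (Q1 Q2 Q3 : 'M[R]_n) z :
  qf (Qcal_1 Q1 Q2 Q3) (bvec 10 z)
  = qf Q1 (z 1%N) + (qf Q2 (z 2%N) - qf Q1 (z 2%N))
    + (qf Q3 (z 4%N) - qf Q2 (z 4%N)).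
Proof.
rewrite qf_bdiag !big_ord_recr big_ord0 /=.
by rewrite !(bfDA, bfNA, bf0A); ring.
Qed.

(** The terms of [P2], [Q12] and [Q22] are exact; inequality enters only through the Wirtinger bound
    for [Z12] and the reciprocally convex bound for [Z22]. *)
Lemma Phi_2_descent (a n1 n2 : nat) P2 (Q12 Q22 Z12 Z22 : 'M[R]_n) X2 g :
  let b := (a + n1 + n2)%N in
  let S2 := Sbar_2 a b P2 Q12 Q22 Z12 Z22 in
  (0 < a)%N -> P2^T = P2 -> posdefmx Z12 -> posdefmx Z22 ->
  posdefmx (Psiz Z22 X2) ->
  qf S2 (bvec b.+1 g) - qf S2 (bvec b.+1 (past g))
  <= qf (Phi_2 a b P2 Q12 Q22 Z12 Z22 X2 (a + n1))
        (bvec 8 (nth 0 (zeta a n1 n2 g))).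
Proof.
move=> b S2 a0 PT Z1pos Z2pos Ppos.
have ab : (a <= b)%N by rewrite /b -addnA leq_addr.
rewrite /S2 !qf_Sbar_2 ?Z1pos.1 ?Z2pos.1 //.
rewrite /Phi_2 /Phi3_2 bfDA bfDA qf_increment // W2_2_zeta W1_2_zeta -/b.
rewrite !(bfDA, bfNA) !bf_mulmx W3_2_zeta Ws_2_zeta WPsi_2_zeta.
rewrite !(bfDA, bfZA) qf_Qcal_2 /=.
have q1 := state_energyB Q12 g (leq0n a); have q2 := state_energyB Q22 g ab.
have z1 := delay_energy_Zcal1 g Z1pos a0.
have z2 := delay_energy_Psiz a n1 n2 g Z2pos Ppos.
rewrite -/b in z2.
have -> : (b - a)%N = (n1 + n2)%N by rewrite /b -addnA addKn.
rewrite -/b; move: q1 q2 z1 z2; lra.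
Qed.

(* The entry [- Q31] at [x(k - dM)] of the functional's increment is absent from
   [Qcal_1]; leaving it out only weakens the bound. *)
Lemma Phi_1_descent (a n1 n2 n3 : nat) P1 (Q11 Q21 Q31 Z11 Z21 Z31 : 'M[R]_n)
    X1 g :
  let b := (a + n1 + n2)%N in
  let S1 := Sbar_1 a b (b + n3) P1 Q11 Q21 Q31 Z11 Z21 Z31 in
  (0 < a)%N -> P1^T = P1 -> posdefmx Q31 -> posdefmx Z11 -> posdefmx Z21 ->
  posdefmx Z31 -> posdefmx (Psiz Z21 X1) ->
  qf S1 (bvec (b + n3).+1 g) - qf S1 (bvec (b + n3).+1 (past g))
  <= qf (Phi_1 a b (b + n3) P1 Q11 Q21 Q31 Z11 Z21 Z31 X1 (a + n1))
        (bvec 10 (nth 0 (zeta1 a n1 n2 n3 g))).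
Proof.
move=> b S1 a0 PT Q3pos Z1pos Z2pos Z3pos Ppos.
have ab : (a <= b)%N by rewrite /b -addnA leq_addr.
have bc : (b <= b + n3)%N by rewrite leq_addr.
rewrite /S1 !qf_Sbar_1 ?Z1pos.1 ?Z2pos.1 ?Z3pos.1 //.
rewrite /Phi_1 /Phi3_1 bfDA bfDA qf_increment // W2_1_zeta W1_1_zeta -/b.
rewrite !(bfDA, bfNA) !bf_mulmx W3_1_zeta Ws_1_zeta WPsi_1_zeta Wz_zeta.
rewrite !(bfDA, bfZA) qf_Qcal_1 /=.
have q1 := state_energyB Q11 g (leq0n a); have q2 := state_energyB Q21 g ab.
have q3 := state_energyB Q31 g bc.
have q3_ge0 := posdefmx_ge0 (g (b + n3).+1) Q3pos.
have z1 := delay_energy_Zcal1 g Z1pos a0.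
have z2 := delay_energy_Psiz a n1 n2 g Z2pos Ppos.
have z3 := delay_energy_Zcal b n3 g Z3pos.
rewrite -/b in z2.
have -> : (b - a)%N = (n1 + n2)%N by rewrite /b -addnA addKn.
rewrite addKn -/b; move: q1 q2 q3 q3_ge0 z1 z2 z3; lra.
Qed.

End Descent.

(** * Uniform decay within a delay interval and at switches *)

Section Decay.
Variables (R : realType).

Lemma negdefmx_coercive p (A : 'M[R]_p) : negdefmx A ->
  exists2 c : R, 0 < c & forall v, qf A v <= - (c * ssq v).
Proof.
move=> /posdefmx_coercive[c c0 hc]; exists c => // v.
by have := hc v; rewrite bfNA lerNr.
Qed.

Lemma negdefmx_coercive2 p (A B : 'M[R]_p) : negdefmx A -> negdefmx B ->
  exists2 c : R, 0 < c &
    forall v, qf A v <= - (c * ssq v) /\ qf B v <= - (c * ssq v).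
Proof.
move=> /negdefmx_coercive[a a0 ha] /negdefmx_coercive[b b0 hb].
exists (Num.min a b) => [|v]; first by rewrite lt_min a0.
have vge0 := ssq_ge0 v.
split; [apply: le_trans (ha v) _ | apply: le_trans (hb v) _];
  by rewrite lerN2 ler_wpM2r // ge_min lexx ?orbT.
Qed.

(** The indices are finitely many, so their constants are combined by a minimum, through induction
    on a bound for [l]. *)
Lemma negdefmx_uniform p (A : nat -> 'M[R]_p) (lo hi : nat) :
  (forall l, (lo <= l <= hi)%N -> negdefmx (A l)) ->
  exists2 c : R, 0 < c &
    forall l, (lo <= l <= hi)%N -> forall v, qf (A l) v <= - (c * ssq v).
Proof.
move=> Aneg; suff /(_ hi.+1)[c c0 hc] : forall N, exists2 c : R, 0 < c &
    forall l, (l < N)%N -> (lo <= l <= hi)%N ->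
      forall v, qf (A l) v <= - (c * ssq v).
  by exists c => // l lh; apply: hc => //; case/andP: lh.
elim=> [|N [c c0 hc]]; first by exists 1.
case: (boolP (lo <= N <= hi)%N) => [Nin|Nout]; last first.
  exists c => // l; rewrite ltnS leq_eqVlt => /orP[/eqP->|lN]; last exact: hc.
  by rewrite (negPf Nout).
have [a a0 ha] := negdefmx_coercive (Aneg N Nin).
exists (Num.min a c) => [|l]; first by rewrite lt_min a0.
rewrite ltnS leq_eqVlt => /orP[/eqP->|lN] lin v.
  by apply: le_trans (ha v) _; rewrite lerN2 ler_wpM2r ?ssq_ge0 // ge_min lexx.
apply: le_trans (hc l lN lin v) _.
by rewrite lerN2 ler_wpM2r ?ssq_ge0 // ge_min lexx orbT.
Qed.

Lemma affine_le (x0 slope B a b d : R) :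
  x0 + a * slope <= B -> x0 + b * slope <= B -> a <= d -> d <= b ->
  x0 + d * slope <= B.
Proof.
move=> ha hb ad db; have [s0|s0] := lerP 0 slope.
  by apply: le_trans hb; rewrite lerD2l ler_wpM2r.
by apply: le_trans ha; rewrite lerD2l ler_wnM2r // ltW.
Qed.

Variable n : nat.
Implicit Types (g z : nat -> 'cV[R]_n).

Lemma ssq_bvec_ge p z i : (i < p)%N -> ssq (z i) <= ssq (bvec p z).
Proof.
move=> ip; rewrite ssq_bvec (bigD1 (Ordinal ip)) //= lerDl.
by apply: sumr_ge0 => j _; exact: ssq_ge0.
Qed.

Lemma Wd_2_bvec d z : Wd_2 R n d *m bvec 8 z = d%:R *: (Wd_2 R n 1 *m bvec 8 z).
Proof.
rewrite !cblock_bvec bvecZ; apply: eq_bvec => -[|[|[|//]]] _;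
  rewrite !big_ord_recr !big_ord0 /=;
  by apply/matrixP => i j; rewrite !mxE; ring.
Qed.

Lemma Wd_1_bvec d z :
  Wd_1 R n d *m bvec 10 z = d%:R *: (Wd_1 R n 1 *m bvec 10 z).
Proof.
rewrite !cblock_bvec bvecZ; apply: eq_bvec => -[|[|[|[|//]]]] _;
  rewrite !big_ord_recr !big_ord0 /=;
  by apply/matrixP => i j; rewrite !mxE; ring.
Qed.

Lemma Phi_2_affine dn dM P2 (Q12 Q22 Z12 Z22 : 'M[R]_n) X2 z :
  exists x0 slope : R, forall d,
    qf (Phi_2 dn dM P2 Q12 Q22 Z12 Z22 X2 d) (bvec 8 z) = x0 + d%:R * slope.
Proof.
(* Both witnesses are filled by unification: [slope] is the symmetrised term at [d = 1], [x0]
   everything else. *)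
do 2!eexists; move=> d; rewrite /Phi_2 3!bfDA qf_mxHe bf_mulmx Wd_2_bvec bfZl.
by rewrite -2!addrA addrCA addrC mulrCA; congr (_ + _).
Qed.

Lemma Phi_1_affine dm dn dM P1 (Q11 Q21 Q31 Z11 Z21 Z31 : 'M[R]_n) X1 z :
  exists x0 slope : R, forall d,
    qf (Phi_1 dm dn dM P1 Q11 Q21 Q31 Z11 Z21 Z31 X1 d) (bvec 10 z)
    = x0 + d%:R * slope.
Proof.
do 2!eexists; move=> d; rewrite /Phi_1 3!bfDA qf_mxHe bf_mulmx Wd_1_bvec bfZl.
by rewrite -2!addrA addrCA addrC mulrCA; congr (_ + _).
Qed.

(* The closed loop after the change of variable [x = J^T xi]; [g] lists
   [xi(k + 1), xi(k), xi(k - 1)] and so on. *)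
Definition step (J A An Ad : 'M[R]_n) (dn d : nat) g :=
  - J^T *m g 0%N + A *m g 1%N + An *m g dn.+1 + Ad *m g d.+1 = 0.

(** On a solution the [Ups_2] term vanishes, and the bound on [Phi_2] extends from the two ends to
    every delay in between, with one constant for all of them. *)
Lemma mode2_decay (dn dM : nat) P2 (Q12 Q22 Z12 Z22 : 'M[R]_n) X2
    eps J A An Ad :
  let S2 := Sbar_2 dn dM P2 Q12 Q22 Z12 Z22 in
  let Phi2 := Phi_2 dn dM P2 Q12 Q22 Z12 Z22 X2 in
  let Ups2 := Ups_2 eps J A An Ad in
  (0 < dn)%N -> (dn <= dM)%N ->
  posdefmx P2 -> posdefmx Z12 -> posdefmx Z22 -> posdefmx (Psiz Z22 X2) ->
  negdefmx (Phi2 dn + Ups2) -> negdefmx (Phi2 dM + Ups2) ->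
  exists2 c : R, 0 < c &
    forall d g, (dn <= d <= dM)%N -> step J A An Ad dn d g ->
    qf S2 (bvec dM.+1 g) <= qf S2 (bvec dM.+1 (past g)) - c * ssq (g 1%N).
Proof.
move=> S2 Phi2 Ups2 dn0 nM Ppos Z1pos Z2pos Psipos /negdefmx_coercive2/[apply].
move=> -[c c0 hc]; exists c => // d g /andP[nd dM_ge] gstep.
have [n1 dE] : exists n1, d = (dn + n1)%N by exists (d - dn)%N; lia.
have [n2 dME] : exists n2, dM = (dn + n1 + n2)%N by exists (dM - d)%N; lia.
pose z := nth 0 (zeta dn n1 n2 g).
have zg1 : ssq (g 1%N) <= ssq (bvec 8 z) by exact: (@ssq_bvec_ge 8 z 1).
have := Phi_2_descent n1 n2 Q12 Q22 g dn0 Ppos.1 Z1pos Z2pos Psipos.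
rewrite /= -dME -/z -dE => desc.
(* Entries 2 and 3 of [z] are the states delayed by [dn] and by [d], so the condition of [qf_Ups_2]
   is [gstep]. *)
have U0 : qf Ups2 (bvec 8 z) = 0 by rewrite qf_Ups_2 // -[RHS]gstep dE.
have [hn hM] := hc (bvec 8 z).
rewrite bfDA U0 addr0 in hn; rewrite bfDA U0 addr0 in hM.
have [x0 [slope hPhi]] := Phi_2_affine dn dM P2 Q12 Q22 Z12 Z22 X2 z.
rewrite !hPhi in hn hM desc.
have hd : x0 + d%:R * slope <= - (c * ssq (bvec 8 z)).
  by apply: affine_le hn hM _ _; rewrite ler_nat.
move: (le_trans desc hd) => h.
have := ler_wpM2l (ltW c0) zg1; rewrite /S2; lra.
Qed.

Lemma mode1_decay (dm dn dM : nat) P1 (Q11 Q21 Q31 Z11 Z21 Z31 : 'M[R]_n) X1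
    eps J A An Ad :
  let S1 := Sbar_1 dm dn dM P1 Q11 Q21 Q31 Z11 Z21 Z31 in
  let Phi1 := Phi_1 dm dn dM P1 Q11 Q21 Q31 Z11 Z21 Z31 X1 in
  let Ups1 := Ups_1 eps J A An Ad in
  (0 < dm)%N -> (dm <= dn)%N -> (dn <= dM)%N ->
  posdefmx P1 -> posdefmx Q31 -> posdefmx Z11 -> posdefmx Z21 -> posdefmx Z31 ->
  posdefmx (Psiz Z21 X1) ->
  negdefmx (Phi1 dm + Ups1) -> negdefmx (Phi1 dn + Ups1) ->
  exists2 c : R, 0 < c &
    forall d g, (dm <= d <= dn)%N -> step J A An Ad dn d g ->
    qf S1 (bvec dM.+1 g) <= qf S1 (bvec dM.+1 (past g)) - c * ssq (g 1%N).
Proof.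
move=> S1 Phi1 Ups1 dm0 mn nM Ppos Q3pos Z1pos Z2pos Z3pos Psipos.
move=> /negdefmx_coercive2/[apply].
move=> -[c c0 hc]; exists c => // d g /andP[md dn_ge] gstep.
have [n1 dE] : exists n1, d = (dm + n1)%N by exists (d - dm)%N; lia.
have [n2 dnE] : exists n2, dn = (dm + n1 + n2)%N by exists (dn - d)%N; lia.
have [n3 dME] : exists n3, dM = (dn + n3)%N by exists (dM - dn)%N; lia.
pose z := nth 0 (zeta1 dm n1 n2 n3 g).
have zg1 : ssq (g 1%N) <= ssq (bvec 10 z) by exact: (@ssq_bvec_ge 10 z 1).
have := Phi_1_descent n1 n2 n3 Q11 Q21 g dm0 Ppos.1 Q3pos Z1pos
  Z2pos Z3pos Psipos.
rewrite /= -dnE -dME -/z -dE => desc.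
(* Here [dn] is the upper end of the interval, so its state is entry 4 of [z]. *)
have U0 : qf Ups1 (bvec 10 z) = 0.
  by rewrite qf_Ups_1 // -[RHS]gstep dE dnE.
have [hm hn] := hc (bvec 10 z).
rewrite bfDA U0 addr0 in hm; rewrite bfDA U0 addr0 in hn.
have [x0 [slope hPhi]] := Phi_1_affine dm dn dM P1 Q11 Q21 Q31 Z11 Z21 Z31 X1 z.
rewrite !hPhi in hm hn desc.
have hd : x0 + d%:R * slope <= - (c * ssq (bvec 10 z)).
  by apply: affine_le hm hn _ _; rewrite ler_nat.
move: (le_trans desc hd) => h.
have := ler_wpM2l (ltW c0) zg1; rewrite /S1; lra.
Qed.

Lemma Lcal_bvec (dn dM : nat) (J A An Ad : 'M[R]_n) l g :
  (0 < dn <= dM)%N -> (0 < l <= dM)%N -> step J A An Ad dn l g ->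
  Lcal dn dM J A An Ad l *m bvec dM.+2 g = 0.
Proof.
move=> /andP[dn0 nM] /andP[l0 lM] <-; rewrite /Lcal mulmxDl; congr (_ + _).
  rewrite mxrow_bvec !big_ord_recl /= addrA; congr (_ + _).
  (* Two block columns have been peeled off, so column [dn.+1] now has index [dn.-1]. *)
  have ndM : (dn.-1 < dM)%N by lia.
  rewrite (bigD1 (Ordinal ndM)) //= big1 => [|i ij]; rewrite /bump /= !add1n.
    by rewrite eqSS prednK // eqxx addr0.
  rewrite !eqSS ifN ?mul0mx //; apply: contra ij => /eqP iE.
  by rewrite -val_eqE /= -iE.
rewrite -mulmxA crow_bvec !big_ord_recl /= !scale0r !add0r; congr (_ *m _).
have llM : (l.-1 < dM)%N by lia.
rewrite (bigD1 (Ordinal llM)) //= big1 => [|i ij]; rewrite /bump /= !add1n.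
  rewrite add0n (nth_map 0%N) ?size_iota // nth_iota // add1n prednK // eqxx.
  by rewrite scale1r addr0.
rewrite add0n (nth_map 0%N) ?size_iota // nth_iota // add1n.
rewrite (_ : (_ == _) = false) ?scale0r //.
apply: contraNF ij => /eqP iE; by rewrite -val_eqE /= -iE.
Qed.

(** On [dM.+2] consecutive states, [bdiag2 S O1] reads the history at time [k + 1] and
    [bdiag2 O1 S'] the one at time [k]; the multiplier term vanishes by [Lcal_bvec]. *)
Lemma switching_decay (dn dM lo hi : nat) eps (S S' : 'M[R]_(bsize dM.+1 n))
    (J A An Ad : 'M[R]_n) :
  let O1 : 'M[R]_(bsize 1 n) := 0 in
  (0 < dn <= dM)%N -> (0 < lo)%N -> (hi <= dM)%N ->
  (forall l, (lo <= l <= hi)%N ->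
     negdefmx ((bdiag2 S O1 - bdiag2 O1 S')
               + mxHe ((Ical n dM eps)^T *m Lcal dn dM J A An Ad l))) ->
  exists2 c : R, 0 < c &
    forall d g, (lo <= d <= hi)%N -> step J A An Ad dn d g ->
    qf S (bvec dM.+1 g) <= qf S' (bvec dM.+1 (past g)) - c * ssq (g 1%N).
Proof.
move=> O1 dn0M lo0 hiM /negdefmx_uniform[c c0 hc]; exists c => // d g dl gstep.
have := hc d dl (bvec dM.+2 g); rewrite bfDA qf_mxHe bfDA bfNA bf_mulmxl.
rewrite !qf_bdiag2 ?addn1 // !bf0A addr0 add0r.
have -> : bf (Lcal dn dM J A An Ad d) (Ical n dM eps *m bvec dM.+2 g)
             (bvec dM.+2 g) = 0.
  rewrite /bf -mulmxA Lcal_bvec ?mulmx0 ?mxE //; lia.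
have zg1 : ssq (g 1%N) <= ssq (bvec dM.+2 g) by exact: ssq_bvec_ge.
have := ler_wpM2l (ltW c0) zg1.
have -> : bvec dM.+1 (fun i => g (1 + i)%N) = bvec dM.+1 (past g) by [].
lra.
Qed.

(** The [P2] term alone gives the bound, since the augmented state begins with [f 0]. *)
Lemma Sbar_2_ge (dn dM : nat) P2 (Q12 Q22 Z12 Z22 : 'M[R]_n) : (dn <= dM)%N ->
  posdefmx P2 -> posdefmx Q12 -> posdefmx Q22 -> posdefmx Z12 -> posdefmx Z22 ->
  exists2 c : R, 0 < c & forall f, c * ssq (f 0%N)
    <= qf (Sbar_2 dn dM P2 Q12 Q22 Z12 Z22) (bvec dM.+1 f).
Proof.
move=> nM Ppos Q1pos Q2pos Z1pos Z2pos.
have [c c0 hc] := posdefmx_coercive Ppos; exists c => // f.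
rewrite qf_Sbar_2 ?Z1pos.1 ?Z2pos.1 //.
have := hc (bvec 3 (nth 0 (summary2 dn dM f))).
have := ler_wpM2l (ltW c0) (@ssq_bvec_ge 3 (nth 0 (summary2 dn dM f)) 0 isT).
have := state_energy_ge0 0 dn f Q1pos; have := state_energy_ge0 dn dM f Q2pos.
have := delay_energy_ge0 0 dn f Z1pos; have := delay_energy_ge0 dn dM f Z2pos.
rewrite /=; lra.
Qed.

Lemma Sbar_1_ge (dm dn dM : nat) P1 (Q11 Q21 Q31 Z11 Z21 Z31 : 'M[R]_n) :
  (dm <= dn)%N -> (dn <= dM)%N ->
  posdefmx P1 -> posdefmx Q11 -> posdefmx Q21 -> posdefmx Q31 ->
  posdefmx Z11 -> posdefmx Z21 -> posdefmx Z31 ->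
  exists2 c : R, 0 < c & forall f, c * ssq (f 0%N)
    <= qf (Sbar_1 dm dn dM P1 Q11 Q21 Q31 Z11 Z21 Z31) (bvec dM.+1 f).
Proof.
move=> mn nM Ppos Q1pos Q2pos Q3pos Z1pos Z2pos Z3pos.
have [c c0 hc] := posdefmx_coercive Ppos; exists c => // f.
rewrite qf_Sbar_1 ?Z1pos.1 ?Z2pos.1 ?Z3pos.1 //.
have := hc (bvec 4 (nth 0 (summary1 dm dn dM f))).
have := ler_wpM2l (ltW c0) (@ssq_bvec_ge 4 (nth 0 (summary1 dm dn dM f)) 0 isT).
have := state_energy_ge0 0 dm f Q1pos; have := state_energy_ge0 dm dn f Q2pos.
have := state_energy_ge0 dn dM f Q3pos.
have := delay_energy_ge0 0 dm f Z1pos; have := delay_energy_ge0 dm dn f Z2pos.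
have := delay_energy_ge0 dn dM f Z3pos.
rewrite /=; lra.
Qed.

End Decay.

(** * The closed loop in plant and error coordinates, and the change of variable *)

Section ClosedLoop.
Variables (R : realType) (np m : nat).
Variables (Ap : 'M[R]_np) (Bp : 'M[R]_(np, m)).

(** In the second block row, subtracting the observer from the plant cancels the input and leaves
    the output injection through [L]. *)
Lemma error_coordinates (K F : 'M[R]_(m, np)) (L : 'M[R]_np)
    (x h y hy xn hn : 'cV[R]_np) :
  let ey := y - hn in
  Acl Ap Bp K *m col_mx x (x - h) + Anmx Bp F L *m col_mx xn (xn - hn)
  + Admx Bp F L *m col_mx y hy
  = col_mx (Ap *m x + Bp *m (K *m h + F *m ey)) (Ap *m (x - h) - L *m ey).
Proof.
rewrite /= !mul_block_col !add_col_mx !mul0mx !addr0 add0r.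
congr col_mx; rewrite !(mulmxDl, mulmxDr, mulmxN, mulNmx) -?mulmxA.
  move: (Ap *m x) (Bp *m _) (Bp *m _) (Bp *m _) (Bp *m _) (Bp *m _).
  by move=> *; apply/matrixP => i j; rewrite !mxE; ring.
move: (Ap *m x) (Ap *m h) (L *m y) (L *m xn) (L *m hn).
by move=> *; apply/matrixP => i j; rewrite !mxE; ring.
Qed.

Lemma closed_loop_delay_system (K F : 'M[R]_(m, np)) (L : 'M[R]_np) dn d
    (xp xh : int -> 'cV[R]_np) :
  closed_loop Ap Bp K F L dn d xp xh <->
  delay_system (Acl Ap Bp K) (Anmx Bp F L) (Admx Bp F L) dn d
    (fun k : int => col_mx (xp k) (xp k - xh k)).
Proof.
split=> [[u [y [ey H]]] k|H].
  have [hx hy hxh hu hey] := H k.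
  rewrite error_coordinates -hy -hey -hu -hx; congr col_mx.
  rewrite hx hxh mulmxBr.
  move: (Ap *m _) (Ap *m _) (Bp *m _) (L *m _).
  by move=> *; apply/matrixP => i j; rewrite !mxE; ring.
pose ey (k : nat) := xp (k%:Z - (d k)%:Z) - xh (k%:Z - dn%:Z).
exists (fun k => K *m xh k%:Z + F *m ey k), (fun k => xp (k%:Z - (d k)%:Z)), ey.
move=> k; have := H k; rewrite error_coordinates => /eq_col_mx[hx he].
(* The observer equation is the difference of the plant and error equations; the plant equation is
   [hx], and the other relations define [u], [y] and [ey]. *)
split=> //; apply: oppr_inj; apply: (addrI (xp k.+1%:Z)).
rewrite he hx mulmxBr -/(ey k).
move: (Ap *m _) (Ap *m _) (Bp *m _) (L *m _).
by move=> *; apply/matrixP => i j; rewrite !mxE; ring.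
Qed.

Variables (U : 'M[R]_np).
Let JT : 'M[R]_(np + np) := block_mx U^T 0 0 U^T.

Lemma tr_blockdiag : (block_mx U 0 0 U)^T = JT.
Proof. by rewrite tr_block_mx !trmx0. Qed.

Lemma blockdiag_unit : U^T \in unitmx -> JT \in unitmx.
Proof. by move=> Uunit; rewrite unitmxE det_ublock unitrM -unitmxE Uunit. Qed.

Lemma Acl_mul (Kb : 'M[R]_(m, np)) : U^T \in unitmx ->
  Acl Ap Bp (Kb *m invmx U^T) *m JT = Abar Ap Bp U Kb.
Proof.
move=> Uunit; rewrite mulmx_block !mulmx0 !mul0mx !addr0 !add0r mulmxDl mulNmx.
by rewrite -!mulmxA mulVmx // !mulmx1.
Qed.

Lemma Anmx_mul (Fb : 'M[R]_(m, np)) (Lb : 'M[R]_np) : U^T \in unitmx ->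
  Anmx Bp (Fb *m invmx U^T) (Lb *m invmx U^T) *m JT = Anmx Bp Fb Lb.
Proof.
move=> Uunit; rewrite mulmx_block !mulmx0 !addr0 !add0r !mulNmx.
by rewrite -!mulmxA mulVmx // !mulmx1.
Qed.

Lemma Admx_mul (Fb : 'M[R]_(m, np)) (Lb : 'M[R]_np) : U^T \in unitmx ->
  Admx Bp (Fb *m invmx U^T) (Lb *m invmx U^T) *m JT = Admx Bp Fb Lb.
Proof.
move=> Uunit; rewrite mulmx_block !mulmx0 !mul0mx !addr0 !mulNmx.
by rewrite -!mulmxA mulVmx // !mulmx1.
Qed.

End ClosedLoop.

(** * Lyapunov argument for asymptotic stability *)

Section Stability.
Variables (R : realType) (n : nat).
Implicit Types (v : 'cV[R]_n) (f g : nat -> 'cV[R]_n).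

(** The norm is the largest absolute entry; if it is nonzero, some entry attains it, and the square
    of that entry is a term of [ssq v]. *)
Lemma norm_sqr_le_ssq v : `|v| ^+ 2 <= ssq v.
Proof.
have [v0|v0] := eqVneq (mx_norm v) 0.
  by rewrite /Num.norm /= v0 expr0n ssq_ge0.
have [[i j] /= vij] := mx_norm_neq0 v0; rewrite /Num.norm /= vij.
rewrite (ord1 j) real_normK ?num_real // /ssq (bigD1 i) //= lerDl.
by apply: sumr_ge0 => l _; exact: sqr_ge0.
Qed.

Lemma ssq_le_norm_sqr v : ssq v <= n%:R * `|v| ^+ 2.
Proof.
rewrite -[n in n%:R]card_ord mulr_natl -sumr_const; apply: ler_sum => i _.
rewrite -[v i 0 ^+ 2]real_normK ?num_real // lerXn2r ?nnegrE ?normr_ge0 //.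
rewrite [leRHS]mx_normrE.
exact: (le_bigmax _ (fun ij : 'I_n * 'I_1 => `|v ij.1 ij.2|) (i, 0)).
Qed.

(** The change of variable [x = T xi]: the values of [xi] at [k], [k - 1] and so on. *)
Definition history (T : 'M[R]_n) (x : int -> 'cV[R]_n) (k : int) :
    nat -> 'cV[R]_n :=
  fun i => invmx T *m x (k - i%:Z).

Lemma past_history T x (k : nat) :
  past (history T x k.+1%:Z) = history T x k%:Z.
Proof.
apply/funext => i; rewrite /past /history; congr (_ *m x _).
by rewrite -[k.+1]addn1 -[i.+1]addn1 !PoszD opprD addrACA subrr addr0.
Qed.

Lemma step_history (A An Ad J : 'M[R]_n) dn d x (k : nat) :
  J^T \in unitmx -> delay_system A An Ad dn d x ->
  step J (A *m J^T) (An *m J^T) (Ad *m J^T) dn (d k) (history J^T x k.+1%:Z).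
Proof.
move=> Ju xsol; have hE i : J^T *m history J^T x k.+1%:Z i = x (k.+1%:Z - i%:Z).
  by rewrite mulKVmx.
rewrite /step mulNmx -!mulmxA !hE subr0 (xsol k).
have subS i : k.+1%:Z - i.+1%:Z = k%:Z - i%:Z.
  by rewrite -[k.+1]addn1 -[i.+1]addn1 !PoszD opprD addrACA subrr addr0.
by rewrite !subS subr0 -!addrA addNr.
Qed.

(** Along a solution [W] is nonincreasing, which bounds the state by the initial history; it also
    converges, so its decrements tend to 0 and with them the state. [W] is an arbitrary function
    because a minimum of two quadratic forms is to be inserted. *)
Lemma lyapunov_stable (A An Ad T : 'M[R]_n) dn dM d
    (W : (nat -> 'cV[R]_n) -> R) (c c1 C : R) :
  T \in unitmx -> 0 < c -> 0 < c1 -> 0 < C ->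
  (forall f, c1 * ssq (f 0%N) <= W f) ->
  (forall f, W f <= C * \sum_(i < dM.+1) ssq (f i)) ->
  (forall x, delay_system A An Ad dn d x -> forall k : nat,
     W (history T x k.+1%:Z)
     <= W (history T x k%:Z) - c * ssq (history T x k%:Z 0%N)) ->
  asymptotically_stable A An Ad dn dM d.
Proof.
move=> Tu c0 c10 C0 Wge Wle Wdec.
have [a a0 ha] := ssq_mulmx_bounded T.
have [b b0 hb] := ssq_mulmx_bounded (invmx T).
have xhist x (k : int) : ssq (x k) <= a * ssq (history T x k 0%N).
  by rewrite -{1}[x k](mulKVmx Tu) /history subr0.
have Wmono x : delay_system A An Ad dn d x -> forall k : nat,
    W (history T x k.+1%:Z) <= W (history T x k%:Z).
  move=> xsol k; apply: le_trans (Wdec x xsol k) _.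
  by rewrite gerBl mulr_ge0 ?ssq_ge0 // ltW.
have W0 x : delay_system A An Ad dn d x -> forall k : nat,
    W (history T x k%:Z) <= W (history T x 0).
  by move=> xsol; elim=> [|k IHk] //; exact: le_trans (Wmono x xsol k) IHk.
split=> [e e0|phi x [xsol _]].
  (* [M] chains the constants from the initial norm to the current one: comparison of norms ([n]),
     inverse of [T] ([b]), upper and lower bounds of [W] ([C], [dM.+1], [c1]), and [T] ([a]). *)
  pose M := a / c1 * (C * (dM.+1%:R * (b * n%:R))).
  have M0 : 0 <= M.
    by rewrite /M !mulr_ge0 ?invr_ge0 // ltW.
  (* It suffices that [M * delta ^+ 2 < e ^+ 2], which holds since [M < (1 + M) ^+ 2]. *)
  exists (e / (1 + M)) => [|phi x [xsol xphi] phi_lt k].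
    by rewrite divr_gt0 // ltr_wpDr.
  set delta := e / (1 + M) in phi_lt.
  have d0 : 0 < delta by rewrite divr_gt0 // ltr_wpDr.
  have hist_le (i : 'I_dM.+1) :
      ssq (history T x 0 i) <= b * n%:R * delta ^+ 2.
    have ki : - dM%:Z <= 0 - i%:Z <= 0 by have := ltn_ord i; lia.
    rewrite -mulrA; apply: le_trans (hb _) _; rewrite ler_pM2l // xphi //.
    apply: le_trans (ssq_le_norm_sqr _) _; rewrite ler_wpM2l //.
    by rewrite lerXn2r ?nnegrE // ltW // phi_lt.
  have W0le : W (history T x 0) <= C * (dM.+1%:R * (b * n%:R)) * delta ^+ 2.
    apply: le_trans (Wle _) _; rewrite -mulrA ler_pM2l //.
    rewrite -mulrA mulr_natl -[X in _ *+ X]card_ord -sumr_const.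
    by apply: ler_sum => i _; exact: hist_le.
  have xk_le : `|x k%:Z| ^+ 2 <= M * delta ^+ 2.
    apply: le_trans (norm_sqr_le_ssq _) _; apply: le_trans (xhist x k) _.
    rewrite /M -!mulrA ler_pM2l // mulrC ler_pdivlMr // mulrC.
    apply: le_trans (Wge _) _; apply: le_trans (W0 x xsol k) _.
    by rewrite !mulrA in W0le *.
  rewrite -(ltr_pXn2r (n := 2)) ?nnegrE ?normr_ge0 ?(ltW e0) //.
  apply: le_lt_trans xk_le _; rewrite /delta expr_div_n mulrA.
  rewrite ltr_pdivrMr ?exprn_gt0 ?ltr_wpDr // mulrC ltr_pM2l ?exprn_gt0 //.
  nra.
pose w (k : nat) := W (history T x k%:Z).
have wcvg : cvgn w.
  apply: nonincreasing_is_cvgn.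
    by apply/nonincreasing_seqP => k; exact: Wmono.
  exists 0 => _ [k _ <-]; apply: le_trans (Wge _).
  by rewrite mulr_ge0 ?ssq_ge0 // ltW.
have wdiff : (fun k => w k - w k.+1) @ \oo --> (0 : R).
  rewrite -(subrr (limn w)); apply: cvgB => //.
  by rewrite -(cvg_shiftS w) in wcvg *.
apply/cvgr0Pnorm_lt => e e0.
(* Threshold for the decrement of [w]: the squared norm of the state is at most [a / c] times that
   decrement. *)
have e'0 : 0 < e ^+ 2 * c / a by rewrite divr_gt0 // mulr_gt0 // exprn_gt0.
move/cvgr0Pnorm_lt : wdiff => /(_ _ e'0); apply: filterS => k hk.
rewrite -(ltr_pXn2r (n := 2)) ?nnegrE ?normr_ge0 ?(ltW e0) //.
apply: le_lt_trans (norm_sqr_le_ssq _) _; apply: le_lt_trans (xhist x k) _.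
have := Wdec x xsol k; rewrite -/(w k) -/(w k.+1) => hw.
have {hk} := le_lt_trans (ler_norm _) hk.
rewrite ltr_pdivlMr // => hk.
rewrite -(ltr_pM2r c0); nra.
Qed.

End Stability.

(** As [invmx] is total, invertibility of [U] belongs to the conclusion: it makes [invmx U^T] the
    inverse that the gains require. *)
Theorem corollary1 (R : realType) (np m dm dn dM : nat)
    (Ap : 'M[R]_np) (Bp : 'M[R]_(np, m)) (eps : R)
    (P1 : 'M[R]_(bsize 4 (np + np))) (P2 : 'M[R]_(bsize 3 (np + np)))
    (Q11 Q21 Z11 Z21 Q12 Q22 Z12 Z22 Q31 Z31 : 'M[R]_(np + np))
    (X1 X2 : 'M[R]_(bsize 2 (np + np)))
    (U : 'M[R]_np) (Kb Fb : 'M[R]_(m, np)) (Lb : 'M[R]_np) :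
  let J : 'M[R]_(np + np) := block_mx U 0 0 U in
  let Ab := Abar Ap Bp U Kb in
  let Adb := Admx Bp Fb Lb in
  let Anb := Anmx Bp Fb Lb in
  let Phi1 := Phi_1 dm dn dM P1 Q11 Q21 Q31 Z11 Z21 Z31 X1 in
  let Phi2 := Phi_2 dn dM P2 Q12 Q22 Z12 Z22 X2 in
  let Ups1 := Ups_1 eps J Ab Anb Adb in
  let Ups2 := Ups_2 eps J Ab Anb Adb in
  let S1 := Sbar_1 dm dn dM P1 Q11 Q21 Q31 Z11 Z21 Z31 in
  let S2 := Sbar_2 dn dM P2 Q12 Q22 Z12 Z22 in
  let O1 : 'M[R]_(bsize 1 (np + np)) := 0 in
  let I0 := Ical (np + np) dM eps in
  let Lc := Lcal dn dM J Ab Anb Adb in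
  let K := Kb *m invmx U^T in
  let F := Fb *m invmx U^T in
  let L := Lb *m invmx U^T in
  (1 <= np)%N -> (1 <= m)%N ->
  (1 <= dm)%N -> (dm <= dn)%N -> (dn <= dM)%N ->
  controllable Ap Bp ->
  -1 < eps <= 0 ->
  posdefmx P1 -> posdefmx P2 ->
  posdefmx Q11 -> posdefmx Q21 -> posdefmx Z11 -> posdefmx Z21 ->
  posdefmx Q12 -> posdefmx Q22 -> posdefmx Z12 -> posdefmx Z22 ->
  posdefmx Q31 -> posdefmx Z31 ->
  posdefmx (Psiz Z21 X1) -> posdefmx (Psiz Z22 X2) ->
  negdefmx (Phi1 dm + Ups1) -> negdefmx (Phi1 dn + Ups1) ->
  negdefmx (Phi2 dn + Ups2) -> negdefmx (Phi2 dM + Ups2) ->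
  (forall l1 : nat, (dm <= l1 <= dn)%N ->
     negdefmx ((bdiag2 S1 O1 - bdiag2 O1 S2) + mxHe (I0^T *m Lc l1))) ->
  (forall l2 : nat, (dn <= l2 <= dM)%N ->
     negdefmx ((bdiag2 S2 O1 - bdiag2 O1 S1) + mxHe (I0^T *m Lc l2))) ->
  U \in unitmx /\
  forall d : nat -> nat, (forall k : nat, (dm <= d k <= dM)%N) ->
    (forall xp xh : int -> 'cV[R]_np,
       closed_loop Ap Bp K F L dn d xp xh <->
       delay_system (Acl Ap Bp K) (Anmx Bp F L) (Admx Bp F L) dn d
         (fun k : int => col_mx (xp k) (xp k - xh k))) /\
    asymptotically_stable (Acl Ap Bp K) (Anmx Bp F L) (Admx Bp F L) dn dM d.
Proof.
move=> J Ab Adb Anb Phi1 Phi2 Ups1 Ups2 S1 S2 O1 I0 Lc K F L _ _ dm0 mn nM _ _.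
move=> P1pos P2pos Q11pos Q21pos Z11pos Z21pos Q12pos Q22pos Z12pos Z22pos.
move=> Q31pos Z31pos Psi1pos Psi2pos Phi1m Phi1n Phi2n Phi2M sw12 sw21.
have dn0 : (0 < dn)%N by exact: leq_trans mn.
have dn0M : (0 < dn <= dM)%N by rewrite dn0.
have [a1 a10 S1ge] :=
  Sbar_1_ge mn nM P1pos Q11pos Q21pos Q31pos Z11pos Z21pos Z31pos.
have [a2 a20 S2ge] := Sbar_2_ge nM P2pos Q12pos Q22pos Z12pos Z22pos.
have [c11 c11_gt0 dec11] := mode1_decay dm0 mn nM P1pos Q31pos Z11pos
  Z21pos Z31pos Psi1pos Phi1m Phi1n.
have [c22 c22_gt0 dec22] := mode2_decay dn0 nM P2pos Z12pos Z22pos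
  Psi2pos Phi2n Phi2M.
have [c12 c12_gt0 dec12] := switching_decay dn0M dm0 nM sw12.
have [c21 c21_gt0 dec21] := switching_decay dn0M dn0 (leqnn dM) sw21.
have Uu : U^T \in unitmx.
  rewrite -unitmx_tr trmxK -row_free_unit -kermx_eq0.
  apply/eqP/row_matrixP => i; rewrite row0.
  have /sub_kermxP kU : (row i (kermx U) <= kermx U)%MS by exact: row_sub.
  set r := row i (kermx U) in kU *.
  (* [r] lies in the left kernel of [U], so [J^T *m v = 0], and the sequence with [v] first and
     zeros after it satisfies [step] with delay [dm]. *)
  pose v : 'cV[R]_(np + np) := col_mx r^T 0.
  pose g (i : nat) := if i == 0 then v else 0.
  have gstep : step J Ab Anb Adb dn dm g.
    rewrite /step /g /= !mulmx0 !addr0 /J tr_blockdiag mulNmx mul_block_col.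
    by rewrite !mulmx0 mul0mx !addr0 -trmx_mul kU trmx0 col_mx0 oppr0.
  have := dec12 dm g; rewrite leqnn mn => /(_ isT gstep).
  have -> : bvec dM.+1 (past g) = 0.
    rewrite -(scale0r (bvec dM.+1 (past g))) bvecZ; apply: eq_bvec => j _.
    by rewrite /past /g /= scale0r.
  rewrite bf0l sub0r => /(le_trans (S1ge g)) gle.
  have : ssq v <= 0.
    rewrite -(pmulr_rle0 _ a10); apply: le_trans gle _.
    by rewrite oppr_le0 mulr_ge0 ?ssq_ge0 // ltW.
  move=> v0; have : `|v| ^+ 2 <= 0 by apply: le_trans (norm_sqr_le_ssq v) v0.
  rewrite exprn_even_le0 //= normr_eq0 -col_mx0 => /eqP/eq_col_mx[rT _].
  by rewrite -[r]trmxK rT trmx0.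
split; first by rewrite -unitmx_tr.
move=> d dbnd; split; first exact: closed_loop_delay_system.
have JTu : J^T \in unitmx by rewrite /J tr_blockdiag; exact: blockdiag_unit.
pose W (f : nat -> 'cV[R]_(np + np)) :=
  Num.min (qf S1 (bvec dM.+1 f)) (qf S2 (bvec dM.+1 f)).
have [b b0 S1le] := qf_bounded S1.
pose c := Num.min (Num.min c11 c12) (Num.min c22 c21).
have c0 : 0 < c by rewrite /c !lt_min c11_gt0 c12_gt0 c22_gt0 c21_gt0.
have weaken (c' x y s : R) : c <= c' -> 0 <= s ->
    x <= y - c' * s -> x <= y - c * s.
  by move=> cc' s0 h; apply: le_trans h _; rewrite lerD2l lerN2 ler_wpM2r.
apply: (@lyapunov_stable _ _ _ _ _ J^T _ _ _ W c (Num.min a1 a2) b JTu c0) => //.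
- by rewrite lt_min a10.
- move=> f; rewrite /W le_min; apply/andP; split.
    apply: le_trans (S1ge f); rewrite ler_wpM2r ?ssq_ge0 //.
    by rewrite ge_min lexx.
  apply: le_trans (S2ge f); rewrite ler_wpM2r ?ssq_ge0 //.
  by rewrite ge_min lexx orbT.
(* A minimum is at most either functional, so an upper bound for [S1] is enough. *)
- move=> f; rewrite -ssq_bvec; apply: le_trans (S1le _).
  by rewrite /W ge_min lexx.
move=> x xsol k; have := step_history k JTu xsol.
rewrite -(past_history J^T x k) {1}/J tr_blockdiag.
rewrite Acl_mul // Anmx_mul // Admx_mul //.
set g := history _ _ _; rewrite -/Ab -/Anb -/Adb => gstep.
rewrite -[past g 0%N]/(g 1%N).
have g0 := ssq_ge0 (g 1%N).
have /andP[dm_le d_leM] := dbnd k.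
have [d_len|n_ltd] := leqP (d k) dn.
  have dk : (dm <= d k <= dn)%N by rewrite dm_le.
  have d11 := dec11 _ _ dk gstep; have d12 := dec12 _ _ dk gstep.
  (* The active functional at time [k + 1] lies below both functionals at time [k], with the
     required decrease, by the decay within its mode and by the switching condition; hence it lies
     below their minimum. *)
  apply: (@le_trans _ _ (qf S1 (bvec dM.+1 g))).
    by rewrite /W ge_min lexx.
  rewrite /W lerBrDr le_min -!lerBrDr; apply/andP; split.
    by apply: weaken d11; rewrite // /c !ge_min lexx.
  by apply: weaken d12; rewrite // /c !ge_min lexx orbT.
have dk : (dn <= d k <= dM)%N by rewrite ltnW.
have d22 := dec22 _ _ dk gstep; have d21 := dec21 _ _ dk gstep.
apply: (@le_trans _ _ (qf S2 (bvec dM.+1 g))).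
  by rewrite /W ge_min lexx orbT.
rewrite /W lerBrDr le_min -!lerBrDr; apply/andP; split.
  by apply: weaken d21; rewrite // /c !ge_min lexx !orbT.
by apply: weaken d22; rewrite // /c !ge_min lexx !orbT.
Qed.
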